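(* Let $r$ and $k$ be integers with $k\ge r+1\ge 3$, and let $F$ be a graph with chromatic number $k$. Then $$\mathrm{spex}_{r}^{\mathrm{lin}}(n,F^{r})=n\left(\frac{1}{r-1}\left(1-\frac{1}{k-1}\right)+o(1)\right)\quad (n\to\infty).$$
   Context: An $r$-uniform hypergraph is linear if any two distinct edges share at most one vertex; it is $F^r$-free if it has no (not necessarily induced) subhypergraph isomorphic to $F^r$. The $r$-expansion $F^r$ of $F$ is obtained by adding to each edge $e$ of $F$ a set $S_e$ of $r-2$ new vertices (pairwise disjoint and disjoint from $V(F)$), with edges $e\cup S_e$. $\mathrm{spex}_r^{\mathrm{lin}}(n,F^r)$ is the maximum spectral radius $\rho(H)$ over all $F^r$-free linear $r$-uniform hypergraphs $H$ on $n$ vertices, where $\rho(H)$ is the maximum modulus of eigenvalues of the adjacency tensor $\mathcal{A}(H)$ (entry $\frac{1}{(r-1)!}$ at $(i_1,\dots,i_r)$ if $\{v_{i_1},\dots,v_{i_r}\}\in E(H)$, else $0$; $\lambda$ is an eigenvalue if $\sum_{i_2,\dots,i_r}a_{ii_2\cdots i_r}x_{i_2}\cdots x_{i_r}=\lambda x_i^{r-1}$ for all $i$ for some $x\ne 0$). *)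

(* Defs.v *)
From HB Require Import structures.
From mathcomp Require Import all_boot all_order all_algebra.
From mathcomp Require Import all_classical all_reals all_analysis.
From mathcomp Require Import complex.

Set Implicit Arguments.
Unset Strict Implicit.
Unset Printing Implicit Defensive.

Import Order.TTheory GRing.Theory Num.Theory.
Local Open Scope ring_scope.

Definition simple_graph (V : finType) (adj : rel V) : Prop :=
  symmetric adj /\ irreflexive adj.

Definition colorable (V : finType) (adj : rel V) (c : nat) : Prop :=
  exists f : V -> 'I_c, forall u v, adj u v -> f u != f v.

Definition chromatic_number_is (V : finType) (adj : rel V) (k : nat) : Prop :=
  colorable adj k /\ forall c, colorable adj c -> (k <= c)%N.

Definition gedges (V : finType) (adj : rel V) : {set {set V}} :=
  [set [set u; v] | u in V, v in V & adj u v].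

Definition gedge_type (V : finType) (adj : rel V) : finType :=
  {e : {set V} | e \in gedges adj}.

Definition uniform (T : finType) (r : nat) (E : {set {set T}}) : Prop :=
  forall e, e \in E -> #|e| = r.

Definition linear_hg (T : finType) (E : {set {set T}}) : Prop :=
  forall e1 e2, e1 \in E -> e2 \in E -> e1 != e2 -> (#|e1 :&: e2| <= 1)%N.

Definition contains_copy (T1 T2 : finType) (G : {set {set T1}})
  (H : {set {set T2}}) : Prop :=
  exists f : T1 -> T2, injective f /\ forall e, e \in G -> f @: e \in H.

Definition expansion_vertex (V : finType) (adj : rel V) (r : nat) : finType :=
  (V + (gedge_type adj * 'I_(r - 2)))%type.

Definition expansion (V : finType) (adj : rel V) (r : nat)
  : {set {set expansion_vertex adj r}} :=
  [set ((@inl V (gedge_type adj * 'I_(r - 2))) @: val ee)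
         :|: [set (inr (ee, j) : expansion_vertex adj r) | j : 'I_(r - 2)]
    | ee : gedge_type adj].

Section Spectral.
Variable R : realType.

Definition cmod (z : R[i]) : R := Num.sqrt (complex.Re z ^+ 2 + complex.Im z ^+ 2).

(* entry a_{i i_2 ... i_r} of the adjacency tensor; t lists (i_2,...,i_r) *)
Definition adj_tensor (n r : nat) (E : {set {set 'I_n}}) (i : 'I_n)
  (t : {ffun 'I_(r.-1) -> 'I_n}) : R :=
  if (i |: [set t j | j : 'I_(r.-1)]) \in E then ((r.-1)`!)%:R^-1 else 0.

Definition tensor_eigenvalue (n r : nat) (E : {set {set 'I_n}}) (l : R[i]) : Prop :=
  exists x : 'I_n -> R[i], (exists i, x i != 0) /\
    forall i : 'I_n,
      \sum_(t : {ffun 'I_(r.-1) -> 'I_n})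
         (Complex (adj_tensor E i t) 0) * \prod_(j : 'I_(r.-1)) x (t j)
      = l * x i ^+ (r.-1).

(* rho(H): the maximum modulus of an eigenvalue (the set is finite and nonempty) *)
Definition spec_radius (n r : nat) (E : {set {set 'I_n}}) : R :=
  sup ([set cmod l | l in [set l | tensor_eigenvalue r E l]])%classic.

Definition spex_lin (r : nat) (V : finType) (adj : rel V) (n : nat) : R :=
  sup ([set spec_radius r E | E in
        [set E : {set {set 'I_n}} | uniform r E /\ linear_hg E /\
                                     ~ contains_copy (expansion adj r) E]])%classic.
End Spectral.

(* Main.v *)
(** Write [K = k - 1].

    Upper bound. If [x] is an eigenvector for [l], then by AM-GM and linearity the
    weights [w_i = |x_i|^(r-1)] satisfy [|l| (r-1) w_i <= sum of w_j over j ~ i],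
    the sum being over the shadow graph. Normalising [w] to a probability vector
    gives a measure with atoms [O(1/n)] for which the shadow has edge density at
    least [|l| (r-1) / n]. If this exceeds [1 - 1/K + eps], the Moon-Moser
    inequality bounds the density of [(K+1)]-cliques below by [eps^K], and cloning
    vertices one at a time (each clone at most squares the density, by
    Cauchy-Schwarz) bounds the homomorphism density of [F] in the shadow below.
    As the atoms are small, a random homomorphism is injective and the hyperedges
    over its edges are disjoint outside [V(F)] with probability close to one, which
    yields a copy of the expansion.

    Lower bound. Take [K] parts, each a copy of an abelian group [G], and for every
    [r]-set [S] of parts the blocks [{(i, a + pos S i z) : i in S}]. The functions
    [pos] are chosen over a prime field so that the difference of two positions
    [pos S j z - pos S i z] determines both [S] and [z] while running over almost
    all of [G]. The resulting hypergraph is linear, regular, and has no edge with two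
    vertices in one part; the indicator of its support is an eigenvector, and it
    contains no expansion of a graph that is not [K]-colourable. *)
Require Import Defs.
From HB Require Import structures.
From mathcomp Require Import all_boot all_order all_algebra.
From mathcomp Require Import all_classical all_reals all_analysis.
From mathcomp Require Import perm complex.
From mathcomp Require Import zify ring lra.
From mathcomp Require Import fintype finset.
Set Implicit Arguments.
Unset Strict Implicit.
Unset Printing Implicit Defensive.
Import Order.TTheory GRing.Theory Num.Theory.
Import numFieldNormedType.Exports.
Local Open Scope ring_scope.

(** * Random maps with independent values *)

Section Expectation.
Variables (R : realFieldType) (X I : finType) (pr : X -> R).
Hypothesis pr_ge0 : forall y, 0 <= pr y.
Hypothesis pr_sum1 : \sum_y pr y = 1.

Definition expect (g : {ffun I -> X} -> R) : R :=
  \sum_(x : {ffun I -> X}) (\prod_i pr (x i)) * g x.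

Definition upd (x : {ffun I -> X}) (i : I) (y : X) : {ffun I -> X} :=
  [ffun j => if j == i then y else x j].

Lemma upd_same x i y : upd x i y i = y.
Proof. by rewrite ffunE eqxx. Qed.

Lemma upd_other x i y j : j != i -> upd x i y j = x j.
Proof. by rewrite ffunE => /negbTE ->. Qed.

Lemma weight_ge0 (x : {ffun I -> X}) : 0 <= \prod_i pr (x i).
Proof. exact: prodr_ge0. Qed.

Lemma weight_sum1 : \sum_(x : {ffun I -> X}) \prod_i pr (x i) = 1.
Proof.
rewrite -(bigA_distr_bigA (fun (_ : I) y => pr y)) /=.
by rewrite big1 // => i _.
Qed.

Lemma expect_le g h : (forall x, g x <= h x) -> expect g <= expect h.
Proof.
by move=> le_gh; apply: ler_sum => x _; rewrite ler_wpM2l ?weight_ge0.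
Qed.

Lemma expect_ge0 g : (forall x, 0 <= g x) -> 0 <= expect g.
Proof. by move=> g0; apply: sumr_ge0 => x _; rewrite mulr_ge0 ?weight_ge0. Qed.

Lemma eq_expect g h : g =1 h -> expect g = expect h.
Proof. by move=> gh; apply: eq_bigr => x _; rewrite gh. Qed.

Lemma expect_cst a : expect (fun=> a) = a.
Proof. by rewrite /expect -mulr_suml weight_sum1 mul1r. Qed.

Lemma expectD g h : expect (fun x => g x + h x) = expect g + expect h.
Proof. by rewrite -big_split; apply: eq_bigr => x _; rewrite mulrDr. Qed.

Lemma expectZ a g : expect (fun x => a * g x) = a * expect g.
Proof. by rewrite mulr_sumr; apply: eq_bigr => x _; rewrite mulrCA. Qed.

Lemma expect_sum (J : finType) (P : pred J) (g : J -> {ffun I -> X} -> R) :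
  expect (fun x => \sum_(j | P j) g j x) = \sum_(j | P j) expect (g j).
Proof.
by rewrite exchange_big; apply: eq_bigr => x _; rewrite mulr_sumr.
Qed.

(** Exchanging the coordinate [x i] with an independent sample [y] is an involution on pairs that
    preserves the product weight. It serves as conditioning on all coordinates other than [i]. *)
Lemma expect_resample i g :
  expect g = expect (fun x => \sum_y pr y * g (upd x i y)).
Proof.
pose w (x : {ffun I -> X}) := \prod_j pr (x j).
pose s (q : {ffun I -> X} * X) := (upd q.1 i q.2, q.1 i).
have sK : involutive s.
  case=> x y; rewrite /s /= upd_same; congr pair; apply/ffunP => j.
  by rewrite !ffunE; case: eqP => // ->.
have ws q : w (s q).1 * pr (s q).2 = w q.1 * pr q.2.
  case: q => x y; rewrite /s /w /= (bigD1 i) // [in RHS](bigD1 i) //=.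
  rewrite upd_same; under eq_bigr => j ji do rewrite upd_other //.
  by rewrite mulrAC [RHS]mulrAC (mulrC (pr y)).
transitivity (\sum_q w q.1 * pr q.2 * g q.1).
  rewrite -(pair_bigA _ (fun x y => w x * pr y * g x)) /=.
  apply: eq_bigr => x _; rewrite -mulr_suml -mulr_sumr pr_sum1 mulr1 //.
rewrite (reindex_inj (inv_inj sK)) /=.
under eq_bigr => q _ do rewrite ws.
rewrite -(pair_bigA _ (fun x y => w x * pr y * g (upd x i y))) /=.
by apply: eq_bigr => x _; rewrite mulr_sumr; apply: eq_bigr => y _; rewrite mulrA.
Qed.

Lemma expect_perm (s : {perm I}) g :
  expect (fun x => g [ffun i => x (s i)]) = expect g.
Proof.
rewrite /expect [RHS](reindex_inj (h := fun x : {ffun I -> X} => [ffun i => x (s i)])) /=.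
  apply: eq_bigr => x _; congr (_ * _).
  rewrite (reindex_inj (@perm_inj _ s)) /=.
  by apply: eq_bigr => i _; rewrite ffunE.
move=> x y /ffunP exy; apply/ffunP => i.
by have := exy ((s^-1)%g i); rewrite !ffunE permKV.
Qed.

(** The mean of [phi * (D - t)^2] is a nonnegative quadratic in [t]; the bound comes from evaluating
    it at a well-chosen [t], its minimiser [b / a] when [a] is nonzero. *)
Lemma expect_CauchySchwarz phi D : (forall x, 0 <= phi x) ->
  expect (fun x => phi x * D x) ^+ 2 <=
  expect phi * expect (fun x => phi x * D x ^+ 2).
Proof.
move=> phi0; set a := expect phi; set b := expect _; set c := expect _.
have a0 : 0 <= a by exact: expect_ge0.
have quad t : 0 <= c - 2 * t * b + t ^+ 2 * a.
  have -> : c - 2 * t * b + t ^+ 2 * a = expect (fun x => phi x * (D x - t) ^+ 2).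
    rewrite -mulNr -!expectZ -!expectD; apply: eq_expect => x; ring.
  by apply: expect_ge0 => x; rewrite mulr_ge0 ?sqr_ge0.
have [a_eq0|a_neq0] := eqVneq a 0.
  rewrite a_eq0 mul0r; have [->|b0] := eqVneq b 0; first by rewrite expr0n.
  (* For [a = 0] the quadratic is affine in [t], and a nonzero [b] would let it take the value [-1]
     at this [t]. *)
  have := quad ((c + 1) / (2 * b)); rewrite a_eq0 mulr0 addr0.
  have -> : c - 2 * ((c + 1) / (2 * b)) * b = -1 by field.
  by rewrite ler0N1.
have := quad (b / a).
have -> : c - 2 * (b / a) * b + (b / a) ^+ 2 * a = (a * c - b ^+ 2) / a.
  by field.
by rewrite pmulr_lge0 ?invr_gt0 ?lt_def ?a_neq0 // subr_ge0.
Qed.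

(** Once the other coordinates are fixed, [Z] is a fixed set of at most [m] points, each hit by the
    independent [x i] with probability at most [M]. *)
Lemma expect_bad_coordinate (Z : {ffun I -> X} -> {set X}) i (m : nat) (M : R) :
  (forall x y, Z (upd x i y) = Z x) -> (forall x, (#|Z x| <= m)%N) ->
  (forall y, pr y <= M) ->
  expect (fun x => (x i \in Z x)%:R) <= m%:R * M.
Proof.
move=> Zi Zm prM; rewrite (expect_resample i).
rewrite -[leRHS]expect_cst; apply: expect_le => x.
under eq_bigr => y _ do rewrite Zi upd_same.
rewrite (bigID (mem (Z x))) /= [X in _ + X]big1 ?addr0; last first.
  by move=> y /negbTE ->; rewrite mulr0.
have M0 : 0 <= M.
  have [y _|noX] := pickP (@predT X); first exact: le_trans (pr_ge0 y) (prM y).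
  by move: pr_sum1; rewrite big_pred0 // => /esym/eqP; rewrite oner_eq0.
apply: le_trans (_ : \sum_(y in Z x) M <= _).
  by apply: ler_sum => y ->; rewrite mulr1.
by rewrite sumr_const -[M *+ _]mulr_natl ler_wpM2r // ler_nat.
Qed.
End Expectation.

(** * Clique densities *)

Section CliqueDensity.
Variables (R : realFieldType) (X I : finType) (pr : X -> R) (A : rel X).
Hypothesis pr_ge0 : forall y, 0 <= pr y.
Hypothesis pr_sum1 : \sum_y pr y = 1.
Hypothesis A_sym : symmetric A.
Variables (k : nat) (c : nat -> I).
Hypothesis c_inj : {in gtn k &, injective c}.

Notation E := (expect pr).

(** Vertices are read through [c] so that the index type may have further coordinates; later these
    hold the clones. *)
Definition clique s (x : {ffun I -> X}) : bool :=
  [forall a : 'I_s, forall b : 'I_s, (a != b) ==> A (x (c a)) (x (c b))].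

(* [i] is a position that [y] need not be adjacent to; [i >= s] imposes all. *)
Definition joined s i (x : {ffun I -> X}) y : bool :=
  [forall a : 'I_s, (a != i :> nat) ==> A (x (c a)) y].

Definition codegree s i (x : {ffun I -> X}) : R :=
  \sum_y pr y * (joined s i x y)%:R.

Definition clique_density s : R := E (fun x => (clique s x)%:R).

Lemma cliqueP s (x : {ffun I -> X}) :
  reflect (forall a b, (a < s)%N -> (b < s)%N -> a != b -> A (x (c a)) (x (c b)))
          (clique s x).
Proof.
apply: (iffP idP) => [/forallP cl a b a_s b_s ab|cl].
  by have /forallP/(_ (Ordinal b_s))/implyP := cl (Ordinal a_s); apply.
by apply/forallP => a; apply/forallP => b; apply/implyP => ab; apply: cl.
Qed.

Lemma joinedP s i (x : {ffun I -> X}) y :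
  reflect (forall a, (a < s)%N -> a != i -> A (x (c a)) y) (joined s i x y).
Proof.
apply: (iffP forallP) => [cl a a_s ai|cl a].
  by have /implyP := cl (Ordinal a_s); apply.
by apply/implyP; apply: cl.
Qed.

Lemma cliqueS s (x : {ffun I -> X}) :
  clique s.+1 x = clique s x && joined s s x (x (c s)).
Proof.
apply/cliqueP/andP => [cl|[/cliqueP cl /joinedP nb] a b].
  split; first by apply/cliqueP => a b a_s b_s; apply: cl; rewrite ltnW.
  by apply/joinedP => a a_s a_neq; apply: cl; rewrite // ltnW.
rewrite !ltnS [(a <= s)%N]leq_eqVlt [(b <= s)%N]leq_eqVlt => /predU1P[->|a_s] /predU1P[->|b_s] ab.
- by rewrite eqxx in ab.
- by rewrite A_sym; apply: nb; rewrite // ltn_eqF.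
- by apply: nb.
- exact: cl.
Qed.

Lemma upd_coord (x : {ffun I -> X}) s a y : (s < k)%N -> (a < s)%N -> upd x (c s) y (c a) = x (c a).
Proof.
move=> s_k a_s; rewrite upd_other //; apply: contraTneq (a_s) => /c_inj ->.
- by rewrite ltnn.
- by rewrite inE (ltn_trans a_s).
- by rewrite inE.
Qed.

Lemma clique_upd s (x : {ffun I -> X}) y : (s < k)%N -> clique s (upd x (c s) y) = clique s x.
Proof.
by move=> s_k; apply/cliqueP/cliqueP => cl a b a_s b_s;
  have := cl a b a_s b_s; rewrite !upd_coord.
Qed.

Lemma joined_upd s (x : {ffun I -> X}) y z :
  (s < k)%N -> joined s s (upd x (c s) y) z = joined s s x z.
Proof.
by move=> s_k; apply/joinedP/joinedP => cl a a_s; have := cl a a_s; rewrite upd_coord.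
Qed.

Lemma codegree_upd s (x : {ffun I -> X}) y :
  (s < k)%N -> codegree s s (upd x (c s) y) = codegree s s x.
Proof. by move=> s_k; apply: eq_bigr => z _; rewrite joined_upd. Qed.

Lemma clique_densityS s : (s < k)%N ->
  clique_density s.+1 = E (fun x => (clique s x)%:R * codegree s s x).
Proof.
move=> s_k; rewrite /clique_density (expect_resample pr_sum1 (c s)).
apply: eq_expect => x; rewrite mulr_sumr; apply: eq_bigr => y _.
rewrite cliqueS clique_upd // joined_upd // upd_same.
by case: clique; case: joined => /=; rewrite !(mulr0, mulr1, mul0r, mul1r).
Qed.

Lemma codegreeS s (x : {ffun I -> X}) : codegree s.+1 s x = codegree s s x.
Proof.
apply: eq_bigr => y _; congr (_ * (nat_of_bool _)%:R).
apply/joinedP/joinedP => nb a a_s a_neq; first by apply: nb; rewrite // ltnW.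
by apply: nb; rewrite // ltn_neqAle a_neq -ltnS.
Qed.

(** Over a fixed [s]-clique, vertex [s] contributes one factor [codegree]; the remaining codegree
    ignores vertex [s] and contributes the second one. *)
Lemma expect_clique_codegree2 s : (s < k)%N ->
  E (fun x => (clique s.+1 x)%:R * codegree s.+1 s x) =
  E (fun x => (clique s x)%:R * codegree s s x ^+ 2).
Proof.
move=> s_k; rewrite (expect_resample pr_sum1 (c s)).
apply: eq_expect => x; rewrite expr2 mulrA mulr_sumr; apply: eq_bigr => y _.
rewrite cliqueS clique_upd // joined_upd // upd_same codegreeS codegree_upd //.
by case: clique; case: joined => /=; rewrite !(mulr0, mulr1, mul0r, mul1r) // mulrC.
Qed.

(** Being a clique is invariant under the transposition of the coordinates [c i] and [c s], so all
    choices of the omitted vertex have the same mean. *)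
Lemma expect_clique_swap s i : (s < k)%N -> (i <= s)%N ->
  E (fun x => (clique s.+1 x)%:R * codegree s.+1 i x) =
  E (fun x => (clique s.+1 x)%:R * codegree s.+1 s x).
Proof.
move=> s_k i_s.
have i_k : (i < k)%N by exact: leq_ltn_trans s_k.
rewrite -[LHS](expect_perm pr (tperm (c i) (c s))).
pose f a := if a == i then s else if a == s then i else a.
have fc a : (a < s.+1)%N -> tperm (c i) (c s) (c a) = c (f a).
  rewrite ltnS /f => a_s; have a_k : (a < k)%N by exact: leq_ltn_trans s_k.
  have [->|a_i] := eqVneq a i; first by rewrite tpermL.
  have [->|a_neq] := eqVneq a s; first by rewrite tpermR.
  by rewrite tpermD //; [apply: contraNneq a_i|apply: contraNneq a_neq] => /c_inj ->.
have f_lt a : (a < s.+1)%N -> (f a < s.+1)%N.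
  by rewrite /f; do 2 case: ifP => //.
have fK : involutive f.
  move=> a; rewrite /f; have [->|a_i] := eqVneq a i.
    by rewrite eqxx; case: eqP.
  have [->|a_s] := eqVneq a s; first by rewrite eqxx.
  by rewrite (negbTE a_i) (negbTE a_s).
apply: eq_expect => x; congr ((nat_of_bool _)%:R * _).
  apply/cliqueP/cliqueP => cl a b a_s b_s ab.
    have := cl (f a) (f b) (f_lt _ a_s) (f_lt _ b_s).
    by rewrite !ffunE !fc ?f_lt // !fK; apply; rewrite (inj_eq (inv_inj fK)).
  by rewrite !ffunE !fc //; apply: cl; rewrite ?f_lt // (inj_eq (inv_inj fK)).
have fs : f s = i by rewrite /f eqxx; case: eqP.
have fi : f i = s by rewrite /f eqxx.
apply: eq_bigr => y _; congr (_ * (nat_of_bool _)%:R).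
apply/joinedP/joinedP => nb a a_s a_neq.
  have := nb (f a) (f_lt _ a_s); rewrite ffunE fc ?f_lt // fK; apply.
  by rewrite -fs (inj_eq (inv_inj fK)).
rewrite ffunE fc //; apply: nb; first exact: f_lt.
by rewrite -fi (inj_eq (inv_inj fK)).
Qed.

(** If [y] misses some vertex [a] of the tuple, only the omission of [a] itself can leave [y] joined
    to the rest. *)
Lemma sum_joined_le s (x : {ffun I -> X}) y :
  (\sum_(i < s.+1) joined s.+1 i x y <= 1 + s * joined s.+1 s.+1 x y)%N.
Proof.
have [nb|] := boolP (joined s.+1 s.+1 x y).
  rewrite muln1 add1n -[X in (_ <= X)%N]card_ord -sum1_card.
  by apply: leq_sum => i _; case: joined.
case/forallPn => a; rewrite negb_imply muln0 addn0 => /andP[_ nAa].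
rewrite (bigD1 a) //= big1 ?addn0 ?leq_b1 // => i i_a.
apply/eqP; rewrite eqb0; apply/forallPn; exists a.
by rewrite negb_imply nAa eq_sym i_a.
Qed.

(** Cauchy-Schwarz for the codegree over [s]-cliques produces pairs of an [s+1]-clique and a point
    joined to all but its last vertex. Averaging over the omitted vertex and applying
    [sum_joined_le] pointwise gives the right-hand side. *)
Lemma Moon_Moser s : (s.+1 < k)%N ->
  s.+1%:R * clique_density s.+1 ^+ 2 <=
  clique_density s * (clique_density s.+1 + s%:R * clique_density s.+2).
Proof.
move=> s_k; have s_k' := ltnW s_k.
have dens_ge0 : 0 <= clique_density s by apply: expect_ge0.
have CS := @expect_CauchySchwarz R X I pr pr_ge0 (fun x => (clique s x)%:R)
  (codegree s s) (fun x => ler0n _ _).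
rewrite -clique_densityS // -expect_clique_codegree2 // in CS.
rewrite -(ler_pM2l (_ : 0 < s.+1%:R :> R)) ?ltr0n // in CS.
apply: le_trans CS _; rewrite mulrCA ler_wpM2l //.
have -> : s.+1%:R * E (fun x => (clique s.+1 x)%:R * codegree s.+1 s x) =
    \sum_(i < s.+1) E (fun x => (clique s.+1 x)%:R * codegree s.+1 i x).
  rewrite (eq_bigr _ (fun i _ => expect_clique_swap s_k' (leq_ord i))).
  by rewrite sumr_const card_ord mulr_natl.
rewrite -expect_sum [clique_density s.+2]clique_densityS // -expectZ -expectD.
apply: expect_le => // x.
rewrite -mulr_sumr mulrCA -[X in X + _]mulr1 -mulrDr ler_wpM2l //.
rewrite exchange_big /= -[X in X + _]pr_sum1 mulr_sumr -big_split /=.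
apply: ler_sum => y _; rewrite -mulr_sumr mulrCA -[X in X + _]mulr1 -mulrDr.
by rewrite ler_wpM2l // -natr_sum -natrM nat1r ler_nat sum_joined_le.
Qed.

(** Consecutive clique densities have ratio at least [1 - s * eta] with [eta = 1/K - eps], by
    induction on [s] through [Moon_Moser]. Each of the [K] ratios is at least [eps], and they are
    multiplied up from density 1. *)
Lemma clique_density_ge (K : nat) (eps : R) : (0 < K)%N -> K.+1 = k -> 0 < eps ->
  1 - K%:R^-1 + eps <= \sum_y \sum_z pr y * pr z * (A y z)%:R ->
  eps ^+ K <= clique_density k.
Proof.
move=> K0 Kk eps0 edge.
pose eta := K%:R^-1 - eps.
have dens1 : clique_density 1 = 1.
  rewrite -[RHS](expect_cst I pr_sum1); apply: eq_expect => x.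
  by rewrite (_ : clique 1 x = true) //; apply/cliqueP => -[] // [].
(* Here [1 - s * eta = (1 - s / K) + s * eps]. *)
have eps_le s : (0 < s <= K)%N -> eps <= 1 - s%:R * eta.
  case/andP=> s0 s_K; rewrite /eta mulrBr.
  have s1 : s%:R / K%:R <= 1 :> R by rewrite ler_pdivrMr ?ltr0n // mul1r ler_nat.
  have s2 : eps <= s%:R * eps by rewrite ler_peMl ?ler1n // ltW.
  lra.
have dens2 : (1 - eta) * clique_density 1 <= clique_density 2.
  rewrite dens1 mulr1 clique_densityS; last by rewrite -Kk ltnS.
  apply: le_trans (_ : 1 - K%:R^-1 + eps <= _); first by rewrite /eta; lra.
  apply: le_trans edge _; rewrite (expect_resample pr_sum1 (c 0)).
  rewrite -[leLHS](expect_cst I pr_sum1); apply: expect_le => // x.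
  apply: ler_sum => y _; rewrite (_ : clique 1 _ = true) ?mul1r; last first.
    by apply/cliqueP => -[] // [].
  rewrite mulr_sumr; apply: ler_sum => z _; rewrite mulrA ler_wpM2l ?mulr_ge0 //.
  rewrite ler_nat; case Ayz: (A y z) => //; rewrite lt0b.
  by apply/joinedP => -[] // _ _; rewrite upd_same.
have step s : (0 < s <= K)%N -> 0 < clique_density s /\
    (1 - s%:R * eta) * clique_density s <= clique_density s.+1.
  elim: s => // -[_ _|s IHs]; first by split; [rewrite dens1|rewrite mul1r].
  case/andP=> _ s_K; case: IHs => [|t0 tS]; first by rewrite /= ltnW.
  have t1 : 0 < clique_density s.+2.
    by apply: lt_le_trans tS; rewrite mulr_gt0 // (lt_le_trans eps0) // eps_le //= ltnW.
  split=> //.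
  (* After cancelling [clique_density s.+1], the induction closes by [(s+2)(1 - (s+1) eta) - 1 =
     (s+1)(1 - (s+2) eta)]. *)
  have /Moon_Moser MM : (s.+2 < k)%N by rewrite -Kk ltnS.
  have : s.+2%:R * clique_density s.+2 * ((1 - s.+1%:R * eta) * clique_density s.+1)
    <= clique_density s.+1 * (clique_density s.+2 + s.+1%:R * clique_density s.+3).
    apply: le_trans MM; rewrite expr2 mulrA ler_wpM2l // mulr_ge0 // ltW //.
  rewrite mulrA mulrC ler_pM2l // => MM'.
  rewrite -(ler_pM2l (_ : 0 < s.+1%:R :> R)) ?ltr0n //.
  move: MM'; rewrite -[s.+2%:R]natr1; set u := s.+1%:R; set v := clique_density _.
  set w := clique_density _ => MM'.
  lra.
have : (K <= K)%N by []; rewrite -{}Kk.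
elim: {1 3 4}K => [|s IHs] s_K; first by rewrite dens1.
have [|t0 tS] := step s.+1; first by [].
apply: le_trans tS; rewrite exprS ler_pM ?exprn_ge0 ?(ltW eps0) ?eps_le //.
by apply: IHs; rewrite ltnW.
Qed.
End CliqueDensity.

(** * Blowing up a clique into a complete multipartite graph *)

Section Cloning.
Variables (R : realFieldType) (X V : finType) (pr : X -> R) (A : rel X).
Hypothesis pr_ge0 : forall y, 0 <= pr y.
Hypothesis pr_sum1 : \sum_y pr y = 1.
Hypothesis A_sym : symmetric A.
Variables (k : nat) (col : V -> 'I_k).

(** [inl] holds one shared representative per colour class, [inr v] a private coordinate for [v]. *)
Definition clone_coord (S : {set V}) v : 'I_k + V :=
  if v \in S then inr v else inl (col v).

(* The vertices outside [S] are still merged with the representative of their colour. *)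
Definition clone_hom (S : {set V}) (x : {ffun 'I_k + V -> X}) : bool :=
  [forall u, forall v, (col u != col v) ==>
     A (x (clone_coord S u)) (x (clone_coord S v))].

Lemma clone_homP (S : {set V}) (x : {ffun 'I_k + V -> X}) :
  reflect (forall u v, col u != col v ->
             A (x (clone_coord S u)) (x (clone_coord S v))) (clone_hom S x).
Proof.
apply: (iffP forallP) => [H u v|H u].
  by have /forallP/(_ v)/implyP := H u.
by apply/forallP => v; apply/implyP; apply: H.
Qed.

(** With all coordinates but the representative of the colour of [v] fixed, the density is the mean
    of [phi * D], where [D] is the measure of admissible representatives. Sampling the clone
    independently from the same set gives the mean of [phi * D^2], and Cauchy-Schwarz with
    [phi <= 1] compares the two. *)
Lemma clone_density (S : {set V}) v : v \notin S ->
  expect pr (fun x => (clone_hom S x)%:R) ^+ 2 <=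
  expect pr (fun x => (clone_hom (v |: S) x)%:R).
Proof.
move=> vS; pose q := clone_coord S; pose rho : 'I_k + V := inl (col v).
(* The adjacencies are split into those avoiding the representative [rho], collected in [phi], and
   those involving it, collected in [nb]. *)
pose phi (x : {ffun 'I_k + V -> X}) := [forall u, forall w,
  [&& col u != col w, q u != rho & q w != rho] ==> A (x (q u)) (x (q w))].
pose nb (x : {ffun 'I_k + V -> X}) y :=
  [forall u, (col u != col v) ==> A y (x (q u))].
have q_rho u : col u != col v -> q u != rho.
  by rewrite /q /clone_coord; case: ifP => // _ uv; apply: contraNneq uv => -[->].
have q_col u : q u = rho -> col u = col v.
  by move=> qu; apply/eqP; apply: contraPT qu => /q_rho/eqP.
have q_v u : q u != inr v.
  by rewrite /q /clone_coord; case: ifP => // uS; apply: contraNneq vS => -[<-].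
have qv : q v = rho by rewrite /q /clone_coord (negbTE vS).
have phi_rho x y : phi (upd x rho y) = phi x.
  by apply: eq_forallb => u; apply: eq_forallb => w; apply: implyb_id2l;
    case/and3P=> _ u_rho w_rho; rewrite !upd_other.
have phi_v x y : phi (upd x (inr v) y) = phi x.
  by apply: eq_forallb => u; apply: eq_forallb => w; rewrite !upd_other.
have nb_rho x y z : nb (upd x rho y) z = nb x z.
  by apply: eq_forallb => u; apply: implyb_id2l => /q_rho u_rho; rewrite upd_other.
have nb_v x y z : nb (upd x (inr v) y) z = nb x z.
  by apply: eq_forallb => u; rewrite upd_other.
have homE x : clone_hom S x = phi x && nb x (x rho).
  apply/clone_homP/andP => [H|[/forallP H1 /forallP H2] u w uw].
    split.
      apply/forallP => u; apply/forallP => w; apply/implyP => /andP[uw _].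
      exact: H.
    by apply/forallP => u; apply/implyP => uv; rewrite A_sym -qv; apply: H.
  rewrite -/(q u) -/(q w).
  have [u_rho|u_rho] := eqVneq (q u) rho.
    rewrite u_rho; have /implyP := H2 w; apply.
    by rewrite -(q_col _ u_rho) eq_sym.
  have [w_rho|w_rho] := eqVneq (q w) rho.
    rewrite w_rho A_sym; have /implyP := H2 u; apply.
    by rewrite -(q_col _ w_rho).
  by have /forallP/(_ w)/implyP := H1 u; apply; rewrite uw u_rho w_rho.
(* Only an implication: if [v] was the last vertex merged into [rho], the right-hand side no longer
   constrains [x rho]. *)
have homE' x : phi x && nb x (x rho) && nb x (x (inr v)) -> clone_hom (v |: S) x.
  rewrite -homE => /andP[/clone_homP H1 /forallP H2]; apply/clone_homP => u w uw.
  have q' t : t != v -> clone_coord (v |: S) t = q t.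
    by move=> tv; rewrite /clone_coord in_setU1 (negbTE tv).
  have q'v : clone_coord (v |: S) v = inr v by rewrite /clone_coord setU11.
  have [u_v|u_v] := eqVneq u v.
    have w_v : w != v by apply: contraNneq uw => ->; rewrite u_v.
    by rewrite u_v q'v q' //; have /implyP := H2 w; apply; rewrite -u_v eq_sym.
  have [w_v|w_v] := eqVneq w v.
    by rewrite w_v q'v q' // A_sym; have /implyP := H2 u; apply; rewrite -w_v.
  by rewrite !q' //; apply: H1.
pose D x := \sum_y pr y * (nb x y)%:R.
have -> : expect pr (fun x => (clone_hom S x)%:R) =
          expect pr (fun x => (phi x)%:R * D x).
  rewrite (expect_resample pr_sum1 rho); apply: eq_expect => x.
  rewrite mulr_sumr; apply: eq_bigr => y _.
  rewrite homE phi_rho nb_rho upd_same.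
  by case: (phi _); case: (nb _ _) => /=; rewrite !(mulr0, mulr1, mul0r, mul1r).
have CS := @expect_CauchySchwarz R X _ pr pr_ge0 (fun x => (phi x)%:R) D
  (fun x => ler0n _ _).
apply: le_trans CS _.
have D2_ge0 : 0 <= expect pr (fun x => (phi x)%:R * D x ^+ 2).
  by apply: expect_ge0 => // x; rewrite mulr_ge0 // sqr_ge0.
apply: le_trans (_ : 1 * expect pr (fun x => (phi x)%:R * D x ^+ 2) <= _).
  rewrite ler_wpM2r // -[leRHS](expect_cst ('I_k + V)%type pr_sum1).
  by apply: expect_le => // x; case: (phi x).
rewrite mul1r.
apply: le_trans (_ : expect pr
  (fun x => (phi x && nb x (x rho) && nb x (x (inr v)))%:R) <= _); last first.
  by apply: expect_le => // x; rewrite ler_nat; case: (_ && _) (@homE' x) => // ->.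
rewrite [leRHS](expect_resample pr_sum1 (inr v)).
have -> : expect pr (fun x => \sum_y pr y *
      (phi (upd x (inr v) y) && nb (upd x (inr v) y) (upd x (inr v) y rho) &&
       nb (upd x (inr v) y) (upd x (inr v) y (inr v)))%:R) =
    expect pr (fun x => (phi x)%:R * (nb x (x rho))%:R * D x).
  apply: eq_expect => x; rewrite mulr_sumr; apply: eq_bigr => y _.
  rewrite phi_v !nb_v upd_same upd_other //.
  by case: (phi _); case: (nb _ _); case: (nb _ _) => /=;
    rewrite !(mulr0, mulr1, mul0r, mul1r).
rewrite [leRHS](expect_resample pr_sum1 rho).
apply: expect_le => // x; rewrite expr2 mulrA mulr_sumr.
apply: ler_sum => y _; rewrite phi_rho nb_rho upd_same.
have -> : D (upd x rho y) = D x by apply: eq_bigr => z _; rewrite nb_rho.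
by rewrite le_eqVlt; apply/orP; left; apply/eqP; ring.
Qed.

(** Cloning the vertices one after another squares the bound [#|V|] times, whence the exponent. *)
Lemma blowup_density :
  expect pr (fun x => (clone_hom set0 x)%:R) ^+ (2 ^ #|V|) <=
  expect pr (fun x => (clone_hom setT x)%:R).
Proof.
have expect0 (S : {set V}) : 0 <= expect pr (fun x => (clone_hom S x)%:R) by apply: expect_ge0.
suff gen (s : seq V) : uniq s ->
    expect pr (fun x => (clone_hom set0 x)%:R) ^+ (2 ^ size s) <=
    expect pr (fun x => (clone_hom [set v in s] x)%:R).
  have := gen (enum V) (enum_uniq V); rewrite -cardE.
  by rewrite (_ : [set v in enum V] = setT) //; apply/setP => v; rewrite !inE mem_enum.
elim: s => [_|v s IHs /= /andP[vs us]].
  by rewrite expr1 (_ : [set v in [::]] = set0) //; apply/setP => v; rewrite !inE.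
rewrite set_cons expnS mulnC exprM.
apply: le_trans (clone_density _); last by rewrite inE.
by rewrite !expr2 ler_pM ?exprn_ge0 ?IHs.
Qed.
End Cloning.

(** * Embedding an expansion into a linear hypergraph *)

Section Embedding.
Variables (X : finType) (r : nat) (E : {set {set X}}).
Hypotheses (E_unif : uniform r E) (E_lin : linear_hg E).

Definition shadow : rel X :=
  fun a b => (a != b) && [exists e in E, (a \in e) && (b \in e)].

(** In a linear hypergraph at most one edge contains two distinct vertices, so the union is that
    edge or empty. The value on the diagonal keeps the cardinality at most [r], whatever the degree
    of [a]. *)
Definition span (a b : X) : {set X} :=
  if a == b then set0 else \bigcup_(e in E | (a \in e) && (b \in e)) e.

(* The images [c'] for which the hyperedge through [c, c'] may touch that through [a, b]
   outside [{a, b}]; the cases [a = b = c] and [b = c] also give injectivity. *)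
Definition forbidden (a b c : X) : {set X} :=
  a |: (span a b :|: \bigcup_(y in span a b) span c y).

Lemma shadow_sym : symmetric shadow.
Proof.
move=> a b; rewrite /shadow eq_sym; congr (_ && _).
by apply: eq_existsb => e; rewrite [(a \in e) && _]andbC.
Qed.

Lemma linear_edge_uniq a b e1 e2 : a != b -> e1 \in E -> e2 \in E ->
  a \in e1 -> b \in e1 -> a \in e2 -> b \in e2 -> e1 = e2.
Proof.
move=> ab e1E e2E ae1 be1 ae2 be2; apply/eqP.
apply: contraT => /(E_lin e1E e2E); rewrite leqNgt => /negP[].
by apply/card_gt1P; exists a, b; rewrite !inE ae1 be1 ae2 be2.
Qed.

Lemma mem_span a b e y : a != b -> e \in E -> a \in e -> b \in e -> y \in e ->
  y \in span a b.
Proof.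
move=> ab eE ae be ye; rewrite /span (negbTE ab); apply/bigcupP.
by exists e; rewrite ?eE ?ae.
Qed.

Lemma card_span a b : (#|span a b| <= r)%N.
Proof.
rewrite /span; have [_|ab] := eqVneq; first by rewrite cards0.
have [e /and3P[eE ae be]|noe] :=
  pickP [pred e | [&& e \in E, a \in e & b \in e]]; last first.
  by rewrite big_pred0 ?cards0.
rewrite -(E_unif eE); apply/subset_leq_card/bigcupsP => e' /and3P[e'E ae' be'].
by rewrite (@linear_edge_uniq a b e e').
Qed.

Lemma card_forbidden a b c : (#|forbidden a b c| <= 1 + r + r * r)%N.
Proof.
apply: leq_trans (leq_card_setU _ _) _; rewrite cards1 -addnA leq_add2l.
apply: leq_trans (leq_card_setU _ _) _; apply: leq_add (card_span a b) _.
apply: leq_trans (leq_mul (card_span a b) (leqnn r)).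
rewrite -sum_nat_const; elim/big_ind2: _ => [|A1 m1 A2 m2 h1 h2|y _].
- by rewrite cards0.
- exact: leq_trans (leq_card_setU _ _) (leq_add h1 h2).
- exact: card_span.
Qed.

(** The new vertices of an edge of the graph go to the vertices of the hyperedge over it that are
    outside the image of the edge. The second condition makes these sets disjoint from the image of
    [V] and from one another. *)
Lemma expansion_embedding (V : finType) (adj : rel V) (x : V -> X) :
  simple_graph adj -> (forall u v, adj u v -> shadow (x u) (x v)) ->
  (forall u v u' v', v' != u -> v' != v -> v' != u' ->
     x v' \notin forbidden (x u) (x v) (x u')) ->
  contains_copy (expansion adj r) E.
Proof.
move=> [adj_sym adj_irr] hom good.
have x_inj : injective x.
  move=> u v xuv; apply/eqP; apply: contraT => uv.
  (* The degenerate quadruple works because [x v] always belongs to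
     [forbidden (x v) (x v) (x v)]. *)
  have := good v v v u uv uv uv.
  by rewrite xuv /forbidden setU11.
have gedgeP (ee : gedge_type adj) : exists u v, adj u v /\ val ee = [set u; v].
  have /imset2P[u v _] := valP ee; rewrite inE => /andP[_ uv] ->.
  by exists u, v.
have hP (ee : gedge_type adj) : exists e, (e \in E) && (x @: val ee \subset e).
  have [u [v [uv ->]]] := gedgeP ee.
  have /andP[_ /existsP[e /and3P[eE ue ve]]] := hom _ _ uv.
  exists e; rewrite eE; apply/subsetP => _ /imsetP[w + ->].
  by rewrite !inE => /orP[] /eqP ->.
pose h ee := xchoose (hP ee).
have hE ee : h ee \in E by have /andP[] := xchooseP (hP ee).
have hS (ee : gedge_type adj) : x @: val ee \subset h ee by have /andP[] := xchooseP (hP ee).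
pose D (ee : gedge_type adj) := h ee :\: (x @: val ee).
have cardD (ee : gedge_type adj) : #|D ee| = (r - 2)%N.
  rewrite cardsD (setIidPr (hS ee)) (E_unif (hE ee)) card_imset //.
  have [u [v [uv ->]]] := gedgeP ee; rewrite cards2.
  by case: eqP uv => // ->; rewrite adj_irr.
pose f (w : expansion_vertex adj r) : X := match w with
  | inl v => x v
  | inr (ee, j) => enum_val (cast_ord (esym (cardD ee)) j) end.
have fD ee j : f (inr (ee, j)) \in D ee by exact: enum_valP.
have in_h (ee : gedge_type adj) u v : val ee = [set u; v] -> x u \in h ee /\ x v \in h ee.
  move=> ee_uv; split; apply: (subsetP (hS ee)); apply: imset_f;
  by rewrite ee_uv !inE eqxx ?orbT.
have x_neq u v : adj u v -> x u != x v by move/hom/andP=> [].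
have Dx w ee : x w \notin D ee.
  apply/negP; rewrite inE => /andP[wee w_h].
  have [u [v [uv ee_uv]]] := gedgeP ee; have [u_h v_h] := in_h _ _ _ ee_uv.
  suff : x w \in forbidden (x u) (x v) (x u).
    apply/negP; apply: good.
    - by apply: contraNneq wee => ->; rewrite imset_f // ee_uv !inE eqxx.
    - by apply: contraNneq wee => ->; rewrite imset_f // ee_uv !inE eqxx orbT.
    - by apply: contraNneq wee => ->; rewrite imset_f // ee_uv !inE eqxx.
  by rewrite !inE (@mem_span _ _ (h ee)) ?x_neq ?orbT.
have DD ee ee' y : y \in D ee -> y \in D ee' -> ee = ee'.
  move=> yD yD'; apply/eqP; apply: contraT => ee_neq.
  have [u [v [uv ee_uv]]] := gedgeP ee; have [u_h v_h] := in_h _ _ _ ee_uv.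
  (* Of two distinct edges, the second has an endpoint outside the first; it is named [v']. A common
     extra vertex [y] would put [x v'] in [span (x u') y] with [y] in [span (x u) (x v)], hence in a
     forbidden set. *)
  have [u' [v' [uv' [ee_uv' v'_ee]]]] : exists u' v',
      adj u' v' /\ val ee' = [set u'; v'] /\ v' \notin val ee.
    have [u' [v' [uv' ee_uv']]] := gedgeP ee'.
    have [v'_ee|v'_ee] := boolP (v' \in val ee); last by exists u', v'.
    exists v', u'; rewrite adj_sym setUC; split=> //; split=> //.
    apply: contra ee_neq => u'_ee.
    rewrite -val_eqE eq_sym eqEcard ee_uv' subUset !sub1set u'_ee v'_ee /=.
    have -> : #|[set u'; v']| = 2.
      by rewrite cards2; case: eqP uv' => // ->; rewrite adj_irr.
    by rewrite ee_uv cards2; case: eqP.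
  have [u'_h v'_h] := in_h _ _ _ ee_uv'.
  move: yD yD'; rewrite !inE => /andP[_ y_h] /andP[y_ee' y_h'].
  suff : x v' \in forbidden (x u) (x v) (x u').
    apply: contraTT => _; apply: good.
    - by apply: contraNneq v'_ee => ->; rewrite ee_uv !inE eqxx.
    - by apply: contraNneq v'_ee => ->; rewrite ee_uv !inE eqxx orbT.
    - by apply: contraTneq uv' => ->; rewrite adj_irr.
  rewrite !inE; apply/orP; right; apply/orP; right; apply/bigcupP; exists y.
    by rewrite (@mem_span _ _ (h ee)) ?x_neq.
  apply: (@mem_span _ _ (h ee')) => //.
  by apply: contraNneq y_ee' => <-; rewrite imset_f // ee_uv' !inE eqxx.
exists f; split.
  case=> [w|[ee j]] [w'|[ee' j']].
  - by move/x_inj->.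
  - by move=> fE; have := fD ee' j'; rewrite -fE (negbTE (Dx _ _)).
  - by move=> fE; have := fD ee j; rewrite fE (negbTE (Dx _ _)).
  move=> fE; have ee_eq : ee = ee' by apply: DD (fD ee j) _; rewrite fE.
  by move: fE; rewrite {}ee_eq => /enum_val_inj/cast_ord_inj ->.
move=> _ /imsetP[ee _ ->].
suff -> : f @: (([set inl v | v in val ee]) :|: [set inr (ee, j) | j : 'I_(r - 2)]) = h ee by [].
rewrite imsetU -imset_comp; apply/setP => y; rewrite in_setU.
apply/orP/idP => [[/imsetP[w w_ee ->]|/imsetP[_ /imsetP[j _ ->] ->]]|y_h].
- by apply: (subsetP (hS ee)); apply: imset_f.
- by have := fD ee j; rewrite in_setD => /andP[].
have [y_ee|y_ee] := boolP (y \in x @: val ee); [by left|right].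
have yD : y \in D ee by rewrite in_setD y_ee.
apply/imsetP; exists (inr (ee, cast_ord (cardD ee) (enum_rank_in yD y))).
  exact: imset_f.
by rewrite /f cast_ord_comp cast_ord_id enum_rankK_in.
Qed.
End Embedding.

(** First moment argument: the expected number of quadruples of vertices that violate the embedding
    condition is below the density of homomorphisms, so some homomorphism has no violation. *)
Lemma copy_of_density (R : realFieldType) (X V : finType) (pr : X -> R) (r K : nat)
  (E : {set {set X}}) (adj : rel V) (eps M : R) :
  (forall y, 0 <= pr y) -> \sum_y pr y = 1 ->
  uniform r E -> linear_hg E -> simple_graph adj -> colorable adj K.+1 ->
  (0 < K)%N -> 0 < eps ->
  1 - K%:R^-1 + eps <= \sum_y \sum_z pr y * pr z * (shadow E y z)%:R ->
  (forall y, pr y <= M) ->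
  (#|V| ^ 4 * (1 + r + r * r))%:R * M < (eps ^+ K) ^+ (2 ^ #|V|) ->
  contains_copy (expansion adj r) E.
Proof.
move=> pr_ge0 pr_sum1 E_unif E_lin adj_simple [col colP] K0 eps0 edge prM M_small.
pose A := shadow E; have A_sym : symmetric A := shadow_sym E.
pose I := ('I_K.+1 + V)%type.
(* The clique is placed on the colour representatives, which the clones then replace. *)
pose c a : I := inl (inord a).
have c_inj : {in gtn K.+1 &, injective c}.
  move=> a b; rewrite !unfold_in => a_K b_K [/(congr1 val)].
  by rewrite /= !inordK.
pose hom (x : {ffun I -> X}) := clone_hom A col setT x.
have hom_dens : (eps ^+ K) ^+ (2 ^ #|V|) <= expect pr (fun x => (hom x)%:R).
  apply: le_trans (blowup_density pr_ge0 pr_sum1 A_sym col).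
  apply: lerXn2r; rewrite ?nnegrE ?exprn_ge0 ?(ltW eps0) ?expect_ge0 //.
  apply: le_trans (clique_density_ge pr_ge0 pr_sum1 A_sym c_inj K0 erefl eps0 edge) _.
  apply: expect_le => // x; rewrite ler_nat.
  case: cliqueP => // cl; rewrite lt0b; apply/clone_homP => u v uv.
  rewrite /clone_coord !inE.
  by have := cl (col u) (col v) (ltn_ord _) (ltn_ord _) uv; rewrite /c !inord_val.
pose Q := (V * V * (V * V))%type.
pose valid (q : Q) :=
  [&& q.2.2 != q.1.1, q.2.2 != q.1.2 & q.2.2 != q.2.1].
pose Z (q : Q) (x : {ffun I -> X}) :=
  forbidden E (x (inr q.1.1)) (x (inr q.1.2)) (x (inr q.2.1)).
have [/existsP[x /andP[/clone_homP x_hom x_good]]|bad] :=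
  boolP [exists x : {ffun I -> X}, hom x &&
    [forall q : Q, valid q ==> (x (inr q.2.2) \notin Z q x)]].
  apply: (expansion_embedding E_unif (x := fun v => x (inr v))) => //.
    move=> u v /colP uv; have := x_hom u v uv.
    by rewrite /clone_coord !in_setT.
  move=> u v u' v' h1 h2 h3.
  have /forallP/(_ ((u, v), (u', v')))/implyP := x_good; apply.
  by rewrite /valid h1 h2.
have : expect pr (fun x => (hom x)%:R) <=
    (#|V| ^ 4 * (1 + r + r * r))%:R * M; last first.
  by move=> /(le_trans hom_dens)/le_lt_trans/(_ M_small); rewrite ltxx.
(* In the absence of a good map, every homomorphism has at least one bad quadruple. *)
apply: le_trans (_ : expect pr (fun x : {ffun I -> X} =>
    \sum_(q : Q | valid q) (x (inr q.2.2) \in Z q x)%:R) <= _).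
  apply: expect_le => // x; rewrite -natr_sum ler_nat.
  case x_hom : (hom x) => //; move: bad; rewrite negb_exists => /forallP/(_ x).
  rewrite x_hom => /forallPn[q]; rewrite negb_imply negbK => /andP[vq qZ].
  by rewrite (bigD1 q) //= qZ.
rewrite expect_sum; apply: le_trans (_ : \sum_(q : Q) (1 + r + r * r)%:R * M <= _).
  have M0 : 0 <= M.
    have [y _|noX] := pickP (@predT X); first exact: le_trans (pr_ge0 y) (prM y).
    by move: pr_sum1; rewrite big_pred0 // => /esym/eqP; rewrite oner_eq0.
  rewrite big_mkcond; apply: ler_sum => q _; case: ifP => [/and3P[q1 q2 q3]|_].
    (* [v'] differs from the three vertices that define the forbidden set, so its coordinate is
       independent of that set. *)
    apply: (@expect_bad_coordinate _ _ _ _ pr_ge0 pr_sum1 (Z q)) => // x => [y|].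
      by rewrite /Z !upd_other // eq_sym.
    exact: card_forbidden.
  by rewrite mulr_ge0 ?ler0n.
by rewrite sumr_const !card_prod -[leLHS]mulr_natl mulrA -natrM !expnS expn0 muln1 !mulnA.
Qed.
(** * Eigenvalues of the adjacency tensor *)

Section TensorEigenvalues.
Variable R : realType.

Lemma normC_cmod (z : R[i]) : `|z| = (cmod z)%:C%C.
Proof. exact: normc_def. Qed.

Lemma cmod_eq0 (z : R[i]) : (cmod z == 0) = (z == 0).
Proof.
rewrite -(normr_eq0 z) normC_cmod; apply/eqP/eqP => [->|] //.
exact: (@complexI R _ 0).
Qed.

Lemma cmodM (y z : R[i]) : cmod (y * z) = cmod y * cmod z.
Proof.
by apply: (@complexI R); rewrite -normC_cmod normrM !normC_cmod rmorphM.
Qed.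

Lemma cmodX (z : R[i]) n : cmod (z ^+ n) = cmod z ^+ n.
Proof.
by apply: (@complexI R); rewrite -normC_cmod normrX normC_cmod rmorphXn.
Qed.

Lemma cmod_prod (T : finType) (P : pred T) (x : T -> R[i]) :
  cmod (\prod_(i | P i) x i) = \prod_(i | P i) cmod (x i).
Proof.
apply: (@complexI R); rewrite -normC_cmod normr_prod rmorph_prod.
by apply: eq_bigr => i _; rewrite normC_cmod.
Qed.

Lemma cmod_sum (T : finType) (P : pred T) (x : T -> R[i]) :
  cmod (\sum_(i | P i) x i) <= \sum_(i | P i) cmod (x i).
Proof.
rewrite -lecR rmorph_sum -normC_cmod; apply: le_trans (ler_norm_sum _ _ _) _.
by apply: ler_sum => i _; rewrite normC_cmod.
Qed.

Lemma cmod_nat n : cmod (n%:R : R[i]) = n%:R.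
Proof. by apply: (@complexI R); rewrite -normC_cmod normr_nat rmorph_nat. Qed.

(** An edge through [i] comes from exactly [(r-1)!] tuples, the injective enumerations of [e :\ i],
    which cancels the tensor entry. *)
Lemma adj_tensor_sum (n r : nat) (E : {set {set 'I_n}}) (x : 'I_n -> R[i]) i :
  (0 < r)%N -> uniform r E ->
  \sum_(t : {ffun 'I_(r.-1) -> 'I_n})
     (Complex (adj_tensor R E i t) 0) * \prod_(j : 'I_(r.-1)) x (t j) =
  \sum_(e in E | i \in e) \prod_(l in e :\ i) x l.
Proof.
move=> r0 E_unif; pose S (t : {ffun 'I_(r.-1) -> 'I_n}) := i |: [set t j | j : 'I_(r.-1)].
rewrite (bigID (fun t => S t \in E)) /= [X in _ + X]big1 ?addr0; last first.
  by move=> t; rewrite /adj_tensor -/(S t) => /negbTE ->; rewrite mul0r.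
rewrite (partition_big S (mem E)) //= [RHS]big_mkcondr /=.
apply: eq_bigr => e eE; case: ifP => [ie|ie]; last first.
  by apply: big1 => t /andP[_ /eqP tS]; rewrite -tS setU11 in ie.
have card_e : #|e :\ i| = r.-1.
  by have := E_unif _ eE; rewrite (cardsD1 i e) ie => <-.
pose T := [set t in ffun_on (mem (e :\ i)) | injectiveb t] : {set {ffun 'I_(r.-1) -> 'I_n}}.
have memT t : (S t \in E) && (S t == e) = (t \in T).
  rewrite inE; apply/andP/andP => [[_ /eqP tS]|[/ffun_onP t_on /injectiveP t_inj]].
    have sub : e :\ i \subset [set t j | j : 'I_(r.-1)].
      apply/subsetP => l; rewrite -tS !inE => /andP[/negbTE-> /=].
      done.
    have im_t : [set t j | j : 'I_(r.-1)] = e :\ i.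
      apply/esym/eqP; rewrite eqEcard sub card_e.
      by rewrite (leq_trans (leq_imset_card _ _)) // card_ord.
    split; first by apply/ffun_onP => j; rewrite -im_t imset_f.
    have /imset_injP t_inj : #|[set t j | j : 'I_(r.-1)]| == #|'I_(r.-1)|.
      by rewrite im_t card_e card_ord.
    by apply/injectiveP => j j'; apply: t_inj.
  suff -> : S t = e by rewrite eE eqxx.
  rewrite -[RHS](setD1K ie); congr (_ |: _); apply/eqP.
  rewrite eqEcard card_imset // card_ord card_e leqnn andbT.
  by apply/subsetP => _ /imsetP[j _ ->]; exact: t_on.
under eq_bigl => t do rewrite memT.
transitivity (\sum_(t in T) (Complex (r.-1)`!%:R^-1 0) * \prod_(l in e :\ i) x l).
  apply: eq_bigr => t tT; have := memT t; rewrite tT => /andP[SE /eqP tS].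
  rewrite /adj_tensor -/(S t) SE; congr (_ * _).
  move: tT; rewrite inE => /andP[/ffun_onP t_on /injectiveP t_inj].
  have -> : e :\ i = [set t j | j : 'I_(r.-1)].
    apply/esym/eqP; rewrite eqEcard card_imset // card_ord card_e leqnn andbT.
    by apply/subsetP => _ /imsetP[j _ ->]; exact: t_on.
  rewrite big_imset //=.
  by move=> j j' _ _; apply: t_inj.
rewrite sumr_const card_inj_ffuns_on card_ord.
have -> : #|mem (e :\ i)| = r.-1 by rewrite -card_e; apply: eq_card.
rewrite ffactnn -mulrnAl -[RHS]mul1r; congr (_ * _).
rewrite -[Complex _ 0]/(((r.-1)`!%:R^-1)%:C%C) -rmorphMn /=.
by rewrite -mulr_natr mulVf ?pnatr_eq0 -?lt0n ?fact_gt0.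
Qed.

(** AM-GM replaces each product over [e :\ i] by a sum of powers. After exchanging sums, each [j] is
    counted at most once, because by linearity only one edge can contain [i] and [j]. *)
Lemma eigenvalue_cmod_le (n r : nat) (E : {set {set 'I_n}}) (x : 'I_n -> R[i])
  (l : R[i]) i : (1 < r)%N -> uniform r E -> linear_hg E ->
  \sum_(t : {ffun 'I_(r.-1) -> 'I_n})
     (Complex (adj_tensor R E i t) 0) * \prod_(j : 'I_(r.-1)) x (t j)
    = l * x i ^+ r.-1 ->
  (r.-1)%:R * cmod l * cmod (x i) ^+ r.-1 <=
  \sum_j (shadow E i j)%:R * cmod (x j) ^+ r.-1.
Proof.
move=> r1 E_unif E_lin; rewrite adj_tensor_sum //; last exact: ltnW.
move/(congr1 (@cmod R)); rewrite cmodM cmodX -mulrA => <-.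
set y := fun j => cmod (x j).
have y0 j : 0 <= y j by exact: sqrtr_ge0.
have m0 : (0 < r.-1)%N by case: r r1 {E_unif} => // -[].
have AMGM (D : {set 'I_n}) : #|D| = r.-1 ->
    (r.-1)%:R * \prod_(j in D) y j <= \sum_(j in D) y j ^+ r.-1.
  move=> cardD; have := @leif_AGM R _ (mem D) (fun j => y j ^+ r.-1).
  rewrite (_ : #|mem D| = r.-1); last by rewrite -cardD; apply: eq_card.
  case=> [j _|+ _]; first exact: exprn_ge0.
  rewrite prodrXl; rewrite ler_pXn2r // ?nnegrE ?prodr_ge0 //; last first.
    by rewrite divr_ge0 // sumr_ge0 // => j _; exact: exprn_ge0.
  by rewrite ler_pdivlMr ?ltr0n // mulrC.
apply: le_trans (_ : \sum_(e in E | i \in e) \sum_(j in e :\ i) y j ^+ r.-1 <= _).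
  apply: le_trans (ler_wpM2l _ (cmod_sum _ _)) _; first exact: ler0n.
  rewrite mulr_sumr; apply: ler_sum => e /andP[eE ie].
  rewrite cmod_prod; apply: AMGM.
  by have := E_unif _ eE; rewrite (cardsD1 i e) ie => <-.
rewrite (exchange_big_dep predT) //=; apply: ler_sum => j _.
rewrite sumr_const -[leLHS]mulr_natl ler_wpM2r ?exprn_ge0 // ler_nat.
case: (pickP (fun e => (e \in E) && (i \in e) && (j \in e :\ i))) => [e|none]; last first.
  by rewrite eq_card0.
move=> /andP[/andP[eE ie]]; rewrite !inE eq_sym => /andP[ij je].
have -> : shadow E i j by rewrite /shadow ij; apply/existsP; exists e; rewrite eE ie.
apply: (@leq_trans #|pred1 e|); last by rewrite card1.
apply/subset_leq_card/subsetP => e'.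
rewrite unfold_in => /andP[/andP[e'E ie']]; rewrite in_setD1 => /andP[_ je'].
by rewrite -topredE /= (linear_edge_uniq E_lin ij e'E eE ie' je' ie je).
Qed.
End TensorEigenvalues.

(** * Upper bound for the spectral radius *)

Section UpperBound.
Variable R : realType.

(** The sign condition on [b] covers the empty set, whose [sup] is 0. *)
Lemma sup_le_nonneg (A : set R) (b : R) :
  0 <= b -> (forall a, A a -> a <= b) -> sup A <= b.
Proof.
move=> b0 Ab; have [->|/set0P A0] := eqVneq A classical_sets.set0; first by rewrite sup0.
exact: ge_sup.
Qed.

Lemma eigenvalue_distribution (n r : nat) (E : {set {set 'I_n}}) (l : R[i]) :
  (1 < r)%N -> uniform r E -> linear_hg E -> tensor_eigenvalue r E l ->
  exists pr : 'I_n -> R, [/\ forall i, 0 <= pr i, \sum_i pr i = 1 &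
    forall i, (r.-1)%:R * cmod l * pr i <= \sum_j (shadow E i j)%:R * pr j].
Proof.
move=> r1 E_unif E_lin [x [[i0 x0] eig]].
pose w i := cmod (x i) ^+ r.-1.
have w0 i : 0 <= w i by rewrite exprn_ge0 // sqrtr_ge0.
have W0 : 0 < \sum_i w i.
  rewrite lt_def sumr_ge0 // andbT psumr_neq0 //; apply/hasP; exists i0.
    exact: mem_index_enum.
  by rewrite lt_def w0 andbT expf_neq0 // cmod_eq0.
exists (fun i => w i / \sum_i w i); split.
- by move=> i; rewrite divr_ge0 // ltW.
- by rewrite -mulr_suml divff // gt_eqF.
move=> i; set W := \sum_i w i.
have -> : \sum_j (shadow E i j)%:R * (w j / W) = (\sum_j (shadow E i j)%:R * w j) / W.
  by rewrite mulr_suml; apply: eq_bigr => j _; rewrite mulrA.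
rewrite mulrA ler_wpM2r ?invr_ge0 ?(ltW W0) //.
exact: eigenvalue_cmod_le.
Qed.

(** Summing the weight inequality over [i] suffices. This crude bound shows that the suprema in
    [spec_radius] and [spex_lin] are over bounded sets, as is required to bound them from below. *)
Lemma eigenvalue_le_order (n r : nat) (E : {set {set 'I_n}}) (l : R[i]) :
  (1 < r)%N -> uniform r E -> linear_hg E -> tensor_eigenvalue r E l ->
  cmod l <= n%:R.
Proof.
move=> r1 E_unif E_lin /(eigenvalue_distribution r1 E_unif E_lin)[pr [pr0 pr1 prE]].
apply: le_trans (_ : (r.-1)%:R * cmod l <= _).
  by rewrite ler_peMl ?sqrtr_ge0 // ler1n; case: (r) r1 => // -[].
have -> : (r.-1)%:R * cmod l = \sum_i (r.-1)%:R * cmod l * pr i.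
  by rewrite -mulr_sumr pr1 mulr1.
apply: (@le_trans _ _ (\sum_i \sum_j (shadow E i j)%:R * pr j)).
  by apply: ler_sum => i _; exact: prE.
rewrite -[X in _ <= X%:R]card_ord -sumr_const.
apply: ler_sum => i _; rewrite -[leRHS]pr1; apply: ler_sum => j _.
by rewrite ler_piMl // lern1 leq_b1.
Qed.

Lemma spec_radius_le_order (n r : nat) (E : {set {set 'I_n}}) :
  (1 < r)%N -> uniform r E -> linear_hg E -> spec_radius R r E <= n%:R.
Proof.
move=> r1 E_unif E_lin; apply: sup_le_nonneg; first exact: ler0n.
by move=> _ [l + <-]; exact: eigenvalue_le_order.
Qed.

(** A larger eigenvalue makes its weight distribution satisfy both requirements of
    [copy_of_density]: weighting the inequality at [i] by [pr i] gives the edge density, and the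
    inequality alone gives small atoms. *)
Lemma eigenvalue_upper (r K n : nat) (V : finType) (adj : rel V) (eps : R)
  (E : {set {set 'I_n}}) (l : R[i]) :
  (1 < r)%N -> (0 < K)%N -> 0 < eps -> simple_graph adj -> colorable adj K.+1 ->
  (#|V| ^ 4 * (1 + r + r * r))%:R < eps * n%:R * (eps ^+ K) ^+ (2 ^ #|V|) ->
  uniform r E -> linear_hg E -> ~ contains_copy (expansion adj r) E ->
  tensor_eigenvalue r E l ->
  (r.-1)%:R * cmod l <= (1 - K%:R^-1 + eps) * n%:R.
Proof.
move=> r1 K0 eps0 adj_simple adj_col n_large E_unif E_lin E_free l_eig.
rewrite leNgt; apply/negP => l_large; apply: E_free.
have [pr [pr0 pr1 prE]] := eigenvalue_distribution r1 E_unif E_lin l_eig.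
have n0 : 0 < n%:R :> R.
  rewrite ltr0n lt0n; apply: contraTneq n_large => ->.
  by rewrite mulr0 mul0r -leNgt.
have K1 : 0 <= 1 - K%:R^-1 :> R by rewrite subr_ge0 invf_le1 ?ler1n ?ltr0n.
set lam := _ * cmod l in l_large prE.
have lam_eps : eps * n%:R <= lam.
  by apply: le_trans (ltW l_large); rewrite ler_wpM2r ?(ltW n0) // lerDr.
have epsn0 : 0 < eps * n%:R by rewrite mulr_gt0.
have lam0 : 0 < lam by exact: lt_le_trans lam_eps.
apply: (@copy_of_density R _ V pr r K E adj eps (eps * n%:R)^-1) => //.
(* The deviation from the uniform distribution has a nonnegative sum of squares. *)
- have sq : n%:R^-1 <= \sum_i pr i ^+ 2.
    have : 0 <= \sum_i (pr i - n%:R^-1) ^+ 2 by apply: sumr_ge0 => i _; exact: sqr_ge0.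
    have -> : \sum_i (pr i - n%:R^-1) ^+ 2 = \sum_i pr i ^+ 2 - n%:R^-1.
      have sqE i : (pr i - n%:R^-1) ^+ 2 =
          pr i ^+ 2 + (- (2 * n%:R^-1)) * pr i + n%:R^-1 ^+ 2 by ring.
      rewrite (eq_bigr _ (fun i _ => sqE i)) !big_split /= -mulr_sumr pr1 mulr1.
      rewrite sumr_const card_ord -[_ ^+ 2 *+ n]mulr_natl.
      by set s := \sum_i _; field; rewrite gt_eqF.
    by rewrite subr_ge0.
  apply: le_trans (_ : lam * n%:R^-1 <= _).
    by rewrite ler_pdivlMr // ltW.
  apply: le_trans (ler_wpM2l (ltW lam0) sq) _.
  rewrite mulr_sumr; apply: ler_sum => i _.
  rewrite expr2 mulrCA; under [leRHS]eq_bigr => j _ do rewrite -mulrA.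
  rewrite -mulr_sumr ler_wpM2l //.
  by under [leRHS]eq_bigr => j _ do rewrite mulrC.
(* [lam * pr i] is at most the total mass 1, and [lam] is at least [eps * n]. *)
- move=> i; apply: (@le_trans _ _ lam^-1); last first.
    by rewrite lef_pV2 ?posrE.
  rewrite -[leRHS]mul1r ler_pdivlMr // mulrC; apply: le_trans (prE i) _.
  rewrite -[leRHS]pr1; apply: ler_sum => j _.
  by rewrite ler_piMl // lern1 leq_b1.
by rewrite ltr_pdivrMr // mulrC.
Qed.

Lemma spex_lin_upper (r K : nat) (V : finType) (adj : rel V) (eps : R) :
  (1 < r)%N -> (0 < K)%N -> 0 < eps -> simple_graph adj -> colorable adj K.+1 ->
  exists n0 : nat, forall n, (n0 <= n)%N ->
    (r.-1)%:R * spex_lin R r adj n <= (1 - K%:R^-1 + eps) * n%:R.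
Proof.
move=> r1 K0 eps0 adj_simple adj_col.
pose C : R := (#|V| ^ 4 * (1 + r + r * r))%:R.
pose d : R := eps * (eps ^+ K) ^+ (2 ^ #|V|).
have d0 : 0 < d by rewrite mulr_gt0 ?exprn_gt0.
have m0 : 0 < (r.-1)%:R :> R by rewrite ltr0n; case: (r) r1 => // -[].
have K1 : 0 <= 1 - K%:R^-1 :> R by rewrite subr_ge0 invf_le1 ?ler1n ?ltr0n.
exists (Num.bound (C / d)) => n n_large.
have Cd : 0 <= C / d by rewrite divr_ge0 ?ler0n // ltW.
have n_ok : C < eps * n%:R * (eps ^+ K) ^+ (2 ^ #|V|).
  rewrite mulrAC -/d -ltr_pdivrMl // mulrC.
  have := archi_boundP Cd; move/lt_le_trans; apply.
  by rewrite ler_nat.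
have b0 : 0 <= (1 - K%:R^-1 + eps) * n%:R by rewrite mulr_ge0 ?ler0n // addr_ge0 // ltW.
rewrite mulrC -ler_pdivlMr //; apply: sup_le_nonneg; first by rewrite divr_ge0 // ltW.
move=> _ [E [E_unif [E_lin E_free]] <-].
apply: sup_le_nonneg; first by rewrite divr_ge0 // ltW.
move=> _ [l l_eig <-]; rewrite ler_pdivlMr // mulrC.
exact: (eigenvalue_upper r1 K0 eps0 adj_simple adj_col n_ok E_unif E_lin E_free l_eig).
Qed.
End UpperBound.

(** * Nearly perfect packings of transversal blocks *)

HB.instance Definition _ (A B : finZmodType) := Finite.on (A * B)%type.
HB.instance Definition _ (I : finType) (A : finZmodType) := Finite.on {ffun I -> A}.

Section SlopeGadget.
Variables (F : fieldType) (p K : nat).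
Hypothesis natr_inj : {in gtn p &, injective (fun m => m%:R : F)}.
Hypothesis K_lt_p : (K < p)%N.

Definition gadget_index : finType := ('I_K * 'I_K * bool)%type.

(** [K] is distinct in [F] from the number of every part, so changing one slope to [K] keeps the
    slopes within a coordinate distinct. *)
Definition gadget_slope (i : 'I_K) (u : gadget_index) : F :=
  (if u.2 && (i == u.1.2) then K else i : nat)%:R.

(** The net factor with which the coordinates [(i, j, true)] and [(i, j, false)] pass on a shift at
    [i] in [gadget_sum]; [gadget_shift] divides by it. *)
Definition gadget_coef (i j : 'I_K) : F :=
  (K%:R - i%:R)^-1 - (j%:R - i%:R)^-1.

Definition gadget_shift (e : 'I_K -> 'I_K -> F) (i : 'I_K) (u : gadget_index) : F :=
  if (i == u.1.1) && (u.1.1 < u.1.2)%N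
  then (-1) ^+ u.2 * (e u.1.1 u.1.2 / gadget_coef u.1.1 u.1.2) else 0.

Lemma gadget_slope_inj u : injective (gadget_slope ^~ u).
Proof.
move=> i j /natr_inj; rewrite !unfold_in.
have iK := ltn_ord i; have jK := ltn_ord j.
case: ifP => [/andP[-> /eqP->]|_]; case: ifP => [/andP[_ /eqP->]|_] //.
- move=> H; have := H K_lt_p (ltn_trans jK K_lt_p) => Kj.
  by rewrite -Kj ltnn in jK.
- move=> H; have := H (ltn_trans iK K_lt_p) K_lt_p => Ki.
  by rewrite Ki ltnn in iK.
by move=> H; apply/val_inj/H; apply: ltn_trans K_lt_p.
Qed.

Lemma gadget_coef_neq0 (i j : 'I_K) : (i < j)%N -> gadget_coef i j != 0.
Proof.
move=> ij; rewrite subr_eq0 (inj_eq invr_inj) (inj_eq (addIr _)).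
apply/eqP => /natr_inj; rewrite !unfold_in => H.
have jK := ltn_ord j; have := H K_lt_p (ltn_trans jK K_lt_p) => Kj.
by rewrite -Kj ltnn in jK.
Qed.

(* The coordinates [(a, b, false)] and [(a, b, true)] carry opposite shifts at the
   part [a] and differ only in the slope of the part [b], so that their
   contributions cancel for all pairs of parts except [{a, b}]. *)
Lemma gadget_sum e (i j : 'I_K) : (i < j)%N ->
  \sum_u (gadget_shift e j u - gadget_shift e i u) /
         (gadget_slope j u - gadget_slope i u) = e i j.
Proof.
move=> ij; have i_neq_j : i != j by rewrite -val_eqE ltn_eqF.
pose f u := (gadget_shift e j u - gadget_shift e i u) /
         (gadget_slope j u - gadget_slope i u).
rewrite -[LHS]/(\sum_u f u).
transitivity (\sum_(ab : 'I_K * 'I_K) (f (ab, true) + f (ab, false))).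
  rewrite -[LHS](pair_bigA _ (fun ab t => f (ab, t))) /=.
  by apply: eq_bigr => ab _; rewrite big_bool.
rewrite (bigD1 (i, j)) //= big1 ?addr0 => [|[a b] ab_neq]; last first.
  rewrite /f /gadget_shift /gadget_slope /=.
  case: (ltnP a b) => ab; last by rewrite !andbF subr0 !mul0r addr0.
  rewrite !andbT /=.
  have [ja|ja] := eqVneq j a.
    have -> : (i == b) = false.
      by apply/negbTE; apply: contraTneq ab => <-; rewrite -leqNgt -ja ltnW.
    have -> : (j == b) = false by rewrite ja -val_eqE ltn_eqF.
    rewrite expr0 expr1 -mulrDl (_ : (i == a) = false); last by rewrite -ja (negbTE i_neq_j).
    by rewrite !subr0 mulN1r mul1r addNr mul0r.
  have [ia|ia] := eqVneq i a; last by rewrite subr0 !mul0r addr0.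
  have -> : (j == b) = false.
    by apply/negbTE; apply: contraNneq ab_neq => ->; rewrite ia.
  have -> : (i == b) = false by rewrite ia -val_eqE ltn_eqF.
  by rewrite expr0 expr1 -mulrDl !sub0r mulN1r mul1r opprK subrr mul0r.
rewrite /f /gadget_shift /gadget_slope /= ij !eqxx (negbTE i_neq_j).
rewrite eq_sym (negbTE i_neq_j) /= expr0 expr1 !sub0r mulN1r mul1r opprK mulNr.
rewrite -mulrBr -/(gadget_coef i j).
by rewrite divfK // gadget_coef_neq0.
Qed.
End SlopeGadget.

(** * Positions whose differences identify the block *)

Section DifferencePacking.
Variables (F : finFieldType) (Y : finZmodType) (p K r : nat).
Hypothesis natr_inj : {in gtn p &, injective (fun m => m%:R : F)}.
Hypothesis K_lt_p : (K < p)%N.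
Hypothesis mulrn_inj : forall d, (0 < d < K)%N -> injective (fun y : Y => y *+ d).

Definition blocks_through (i j : 'I_K) : {set {set 'I_K}} :=
  [set S : {set 'I_K} | [&& #|S| == r, i \in S & j \in S]].

Variable N : nat.
Hypothesis card_blocks : forall i j : 'I_K, (i < j)%N -> (#|blocks_through i j| <= N)%N.

Definition block_rank (S : {set 'I_K}) (i j : 'I_K) : nat :=
  index S (enum (blocks_through i j)).

Definition rank_shift (S : {set 'I_K}) (i j : 'I_K) : F := (block_rank S i j)%:R.

(** The range [p %/ N] leaves room to add a rank below [N] to [b * N] without reaching [p]. When
    [#|F| = p], the parameters number about a fraction [1 / N] of the group. *)
Definition block_param : finType :=
  ('I_(p %/ N) * {ffun gadget_index K -> F} * Y)%type.

Definition block_group : finZmodType :=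
  (F * {ffun gadget_index K -> F} * Y)%type.

(** The first component carries [b] masked by the sum of [h], the second carries [h] perturbed by
    the rank of [S], and the third is free filling that adapts the order of the group to [n]. *)
Definition block_pos (S : {set 'I_K}) (i : 'I_K) (z : block_param) : block_group :=
  (i%:R * ((z.1.1 * N)%:R - \sum_u z.1.2 u),
   [ffun u => gadget_slope F i u * z.1.2 u +
              gadget_shift (rank_shift S) i u],
   z.2 *+ i).

Lemma block_pos_diff S S' (i j : 'I_K) b h y b' h' y' :
  block_pos S j (b, h, y) - block_pos S i (b, h, y) =
  block_pos S' j (b', h', y') - block_pos S' i (b', h', y') ->
  [/\ (j%:R - i%:R) * ((b * N)%:R - \sum_u h u) =
       (j%:R - i%:R) * ((b' * N)%:R - \sum_u h' u),
      forall u,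
        (gadget_slope F j u - gadget_slope F i u) * h u +
        (gadget_shift (rank_shift S) j u - gadget_shift (rank_shift S) i u) =
        (gadget_slope F j u - gadget_slope F i u) * h' u +
        (gadget_shift (rank_shift S') j u - gadget_shift (rank_shift S') i u) &
      y *+ j - y *+ i = y' *+ j - y' *+ i].
Proof.
move=> pos_eq; split.
- rewrite 2![(j%:R - _) * _]mulrBl.
  exact: (congr1 (fun g : block_group => g.1.1) pos_eq).
- move=> u.
  have sub_coord (g g' : block_group) : (g - g').1.2 u = g.1.2 u - g'.1.2 u.
    by case: g g' => [[? ?] ?] [[? ?] ?]; rewrite /= !ffunE.
  have pos_coord T a (z : block_param) : (block_pos T a z).1.2 u =
      gadget_slope F a u * z.1.2 u + gadget_shift (rank_shift T) a u by rewrite ffunE.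
  have : (block_pos S j (b, h, y)).1.2 u - (block_pos S i (b, h, y)).1.2 u =
      (block_pos S' j (b', h', y')).1.2 u - (block_pos S' i (b', h', y')).1.2 u.
    by rewrite -!sub_coord pos_eq.
  rewrite (pos_coord S j) (pos_coord S i) (pos_coord S' j) (pos_coord S' i).
  have expand (a c s t k : F) : a * k + s - (c * k + t) = (a - c) * k + (s - t) by ring.
  by rewrite !expand.
exact: (congr1 (fun g : block_group => g.2) pos_eq).
Qed.

(* The slopes do not depend on [S], so dividing the coordinates of the difference by
   the slope differences and summing recovers [b * N + rank of S], which has no
   overflow modulo [p]. *)
Lemma block_pos_diff_inj S S' (i j : 'I_K) z z' : (i < j)%N ->
  S \in blocks_through i j -> S' \in blocks_through i j ->
  block_pos S j z - block_pos S i z = block_pos S' j z' - block_pos S' i z' ->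
  S = S' /\ z = z'.
Proof.
move=> ij Sij S'ij.
have i_neq_j : i != j by rewrite -val_eqE ltn_eqF.
case: z => [[b h] y]; case: z' => [[b' h'] y'] /block_pos_diff[diff1 diff2 diff3].
have ji_neq0 : j%:R - i%:R != 0 :> F.
  rewrite subr_eq0; apply: contraNneq i_neq_j => /natr_inj ji.
  by apply/eqP/val_inj/esym/ji; rewrite unfold_in; apply: ltn_trans K_lt_p.
have first_coord := mulfI ji_neq0 diff1.
have slope_neq0 u : gadget_slope F j u - gadget_slope F i u != 0.
  by rewrite subr_eq0; apply: contraNneq i_neq_j =>
    /(gadget_slope_inj natr_inj K_lt_p) ->.
have coord u : h u + (gadget_shift (rank_shift S) j u - gadget_shift (rank_shift S) i u) /
         (gadget_slope F j u - gadget_slope F i u) =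
    h' u + (gadget_shift (rank_shift S') j u - gadget_shift (rank_shift S') i u) /
         (gadget_slope F j u - gadget_slope F i u).
  apply: (mulfI (slope_neq0 u)).
  have expand (a k s : F) : k != 0 -> k * (a + s / k) = k * a + s.
    by move=> k0; field.
  by rewrite !expand.
have sum_coord : \sum_u h u + rank_shift S i j = \sum_u h' u + rank_shift S' i j.
  rewrite -(gadget_sum natr_inj K_lt_p (rank_shift S) ij).
  rewrite -(gadget_sum natr_inj K_lt_p (rank_shift S') ij).
  by rewrite -!big_split; apply: eq_bigr => u _; exact: coord.
have rank_lt T : T \in blocks_through i j -> (block_rank T i j < N)%N.
  by move=> Tij; apply: leq_trans (card_blocks ij); rewrite cardE index_mem mem_enum.
have bN_lt (c : 'I_(p %/ N)) T : T \in blocks_through i j ->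
    (c * N + block_rank T i j < p)%N.
  move=> /rank_lt T_lt; apply: leq_trans (leq_trunc_div p N).
  by apply: (@leq_trans (c.+1 * N)); rewrite ?leq_mul2r ?ltn_ord ?orbT // mulSn addnC ltn_add2r.
have nat_eq : (b * N + block_rank S i j = b' * N + block_rank S' i j)%N.
  apply: natr_inj; [exact: bN_lt|exact: bN_lt|].
  rewrite natrD [RHS]natrD; move: first_coord sum_coord.
  set s := \sum_u h u; set s' := \sum_u h' u => fc sc.
  by rewrite -(subrK s (b * N)%:R) fc -addrA sc addrA subrK.
have N0 : (0 < N)%N by apply: leq_ltn_trans (rank_lt _ Sij).
have rank_eq : block_rank S i j = block_rank S' i j.
  by have := congr1 (modn^~ N) nat_eq; rewrite /= !modnMDl !modn_small ?rank_lt.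
have SS' : S = S'.
  have S_enum : S \in enum (blocks_through i j) by rewrite mem_enum.
  by rewrite -(nth_index S S_enum) -/(block_rank S i j) rank_eq nth_index // mem_enum.
split=> //; congr (_, _, _).
- apply/val_inj/eqP; rewrite -(eqn_pmul2r N0); apply/eqP.
  by move: nat_eq; rewrite rank_eq => /addIn.
- by apply/ffunP => u; have := coord u; rewrite SS' => /addIr.
apply: (@mulrn_inj (j - i)); last first.
  by rewrite /= !mulrnBr ?(ltnW ij).
by rewrite subn_gt0 ij (leq_ltn_trans (leq_subr _ _)).
Qed.
End DifferencePacking.

Lemma card_supersets (T : finType) (X : {set T}) r : (#|X| <= r)%N ->
  #|[set S : {set T} | (#|S| == r) && (X \subset S)]| = 'C(#|T| - #|X|, r - #|X|).
Proof.
move=> X_r; have <- : #|~: X| = (#|T| - #|X|)%N by rewrite -(cardsC X) addKn.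
rewrite -cards_draws; set D := [set A : {set T} | A \subset ~: X & _].
have X_disj A : A \in D -> X :&: A = set0.
  rewrite inE => /andP[AX _].
  by apply: disjoint_setI0; rewrite disjoint_sym disjoints_subset.
have X_diff A : A \in D -> (X :|: A) :\: X = A.
  move=> AD; rewrite setDUl setDv set0U; apply/setDidPl.
  by rewrite -setI_eq0 setIC X_disj.
rewrite -(card_in_imset (f := fun A => X :|: A) (D := D)); last first.
  by move=> A B AD BD eqAB; rewrite -(X_diff A) // -(X_diff B) // eqAB.
apply: eq_card => S; apply/idP/imsetP => [|[A AD ->]].
  rewrite inE => /andP[/eqP S_r XS]; exists (S :\: X).
    by rewrite inE subDset setUCr subsetT cardsD (setIidPr XS) S_r eqxx.
  by rewrite setUC setDE setUIl (setUidPl XS) setUC setUCr setIT.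
have := AD; rewrite !inE => /andP[_ /eqP A_r].
by rewrite subsetUl andbT cardsU A_r X_disj // cards0 subn0 subnKC.
Qed.

(** * The hypergraph of translated blocks *)

Section Packing.
Variables (K r n : nat) (G : finZmodType) (Z : finType).
Variable pos : {set 'I_K} -> 'I_K -> Z -> G.
Hypothesis r_gt1 : (1 < r)%N.
Hypothesis pos_inj : forall (S S' : {set 'I_K}) (i j : 'I_K) z z', (i < j)%N ->
  #|S| = r -> #|S'| = r -> i \in S -> j \in S -> i \in S' -> j \in S' ->
  pos S j z - pos S i z = pos S' j z' - pos S' i z' -> S = S' /\ z = z'.
Variable emb : 'I_K * G -> 'I_n.
Hypothesis emb_inj : injective emb.

Definition block (q : {set 'I_K} * G * Z) : {set 'I_n} :=
  [set emb (i, q.1.2 + pos q.1.1 i q.2) | i in q.1.1].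

Definition packing : {set {set 'I_n}} :=
  [set block q | q in [pred q : {set 'I_K} * G * Z | #|q.1.1| == r]].

Lemma mem_block i x (q : {set 'I_K} * G * Z) :
  (emb (i, x) \in block q) = (i \in q.1.1) && (x == q.1.2 + pos q.1.1 i q.2).
Proof.
apply/imsetP/andP => [[j jS /emb_inj[-> ->]]|[iS /eqP ->]]; first by rewrite eqxx.
by exists i.
Qed.

(** The translation cancels in the difference of two vertices, so [pos_inj] recovers [S] and [z];
    one vertex then gives the translation. *)
Lemma block_inj2 v w (q q' : {set 'I_K} * G * Z) : v != w -> #|q.1.1| = r -> #|q'.1.1| = r ->
  v \in block q -> w \in block q -> v \in block q' -> w \in block q' -> q = q'.
Proof.
move=> vw qr q'r vq wq vq' wq'.
have [[i x] v_ix] : exists u, v = emb u by case/imsetP: vq => i _ ->; eexists.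
have [[j y] w_jy] : exists u, w = emb u by case/imsetP: wq => j _ ->; eexists.
subst v w; move: vq wq vq' wq'; rewrite !mem_block.
move=> /andP[iS /eqP xq] /andP[jS /eqP yq] /andP[iS' /eqP xq'] /andP[jS' /eqP yq'].
case: q => [[S a] z] in qr iS jS xq yq *; case: q' => [[S' a'] z'] in q'r iS' jS' xq' yq' *.
rewrite /= in qr iS jS xq yq q'r iS' jS' xq' yq' *.
have diff b s t : (b + s) - (b + t) = s - t :> G by rewrite opprD addrACA subrr add0r.
have [SS' zz'] : S = S' /\ z = z'.
  have [ij|ji|ij] := ltngtP i j.
  - by apply: (@pos_inj S S' i j) => //;
    rewrite -(diff a (pos S j z)) -(diff a' (pos S' j z')) -yq -xq -yq' -xq'.
  - by apply: (@pos_inj S S' j i) => //;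
    rewrite -(diff a (pos S i z)) -(diff a' (pos S' i z')) -yq -xq -yq' -xq'.
  by case/eqP: vw; rewrite xq yq (val_inj ij).
by subst S' z'; congr (_, _, _); apply: (addIr (pos S i z)); rewrite -xq.
Qed.

Lemma packing_edgeP e : e \in packing -> exists2 q : {set 'I_K} * G * Z, #|q.1.1| = r & e = block q.
Proof. by case/imsetP => q; rewrite unfold_in => /eqP qr ->; exists q. Qed.

Lemma card_block (q : {set 'I_K} * G * Z) : #|block q| = #|q.1.1|.
Proof. by rewrite card_in_imset // => i j _ _ /emb_inj[]. Qed.

Lemma packing_uniform : uniform r packing.
Proof. by move=> e /packing_edgeP[q qr ->]; rewrite card_block. Qed.

Lemma packing_linear : linear_hg packing.
Proof.
move=> e1 e2 /packing_edgeP[q qr ->] /packing_edgeP[q' q'r ->] neq.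
rewrite leqNgt; apply: contra neq => /card_gt1P[v [w [+ + vw]]].
rewrite !inE => /andP[vq vq'] /andP[wq wq'].
by rewrite (block_inj2 vw qr q'r).
Qed.

(** For every [S] through the part [i] and every [z], exactly one translation brings the block to
    the given vertex. *)
Lemma packing_degree u :
  #|[set e in packing | emb u \in e]| = ('C(K.-1, r.-1) * #|Z|)%N.
Proof.
case: u => i x.
pose B := [set S : {set 'I_K} | (#|S| == r) && ([set i] \subset S)].
pose f (q : {set 'I_K} * Z) := block (q.1, x - pos q.1 i q.2, q.2).
have -> : [set e in packing | emb (i, x) \in e] = f @: setX B [set: Z].
  apply/setP => e; rewrite inE; apply/andP/imsetP => [[]|[[S z]]].
    move=> /packing_edgeP[[[S a] z] /= qr ->]; rewrite mem_block /= => /andP[iS /eqP xa].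
    exists (S, z); first by rewrite !inE sub1set qr eqxx iS.
    by rewrite /f /= xa addrK.
  rewrite !inE sub1set => /andP[/andP[S_r iS] _] ->.
  rewrite mem_block /= iS subrK eqxx; split=> //.
  by apply/imsetP; exists (S, x - pos S i z, z).
rewrite card_in_imset; last first.
  move=> [S z] [S' z']; rewrite !inE !andbT /= => /andP[/eqP S_r _] /andP[/eqP S'_r _].
  (* Since [r > 1], a block has two vertices, which determine its parameters. *)
  move=> fE; have : (1 < #|f (S, z)|)%N by rewrite card_block S_r.
  case/card_gt1P => v [w [v1 w1 vw]].
  have := @block_inj2 v w (S, x - pos S i z, z) (S', x - pos S' i z', z') vw S_r S'_r v1 w1.
  rewrite -[block _]/(f (S', z')) -fE.
  by move=> /(_ v1 w1)[-> _ ->].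
by rewrite cardsX cardsT card_supersets cards1 ?card_ord ?subn1 // ltnW.
Qed.

(** A block meets each part at most once, so sending a vertex to the part of its image would
    properly colour the graph with [K] colours. *)
Lemma packing_free (V : finType) (adj : rel V) :
  (0 < K)%N -> irreflexive adj -> ~ colorable adj K -> ~ contains_copy (expansion adj r) packing.
Proof.
move=> K0 adj_irr not_col [f [f_inj f_edge]]; apply: not_col.
(* The default part is harmless: a vertex outside the image of [emb] lies in no block, so only
   isolated vertices of the graph can be sent there. *)
pose part (w : 'I_n) : 'I_K :=
  if [pick u | emb u == w] is Some u then u.1 else Ordinal K0.
have part_emb u : part (emb u) = u.1.
  by rewrite /part; case: pickP => [u' /eqP/emb_inj ->|/(_ u)] //; rewrite eqxx.
exists (fun v => part (f (inl v))) => u v uv; apply/eqP => part_uv.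
have ee_in : [set u; v] \in gedges adj.
  by apply/imset2P; exists u v => //; rewrite inE uv.
pose ee : gedge_type adj := exist (fun e : {set V} => e \in gedges adj) [set u; v] ee_in.
pose e0 := (@inl V (gedge_type adj * 'I_(r - 2)) @: val ee)
         :|: [set (inr (ee, j) : expansion_vertex adj r) | j : 'I_(r - 2)].
have /f_edge/packing_edgeP[q qr eq_q] : e0 \in expansion adj r by exact: imset_f.
have val_ee : val ee = [set u; v] by [].
have in_block w : w \in val ee -> f (inl w) \in block q.
  by move=> w_ee; rewrite -eq_q imset_f // inE imset_f.
have /imsetP[i _ fu] : f (inl u) \in block q by apply: in_block; rewrite val_ee !inE eqxx.
have /imsetP[j _ fv] : f (inl v) \in block q by apply: in_block; rewrite val_ee !inE eqxx orbT.
move: part_uv; rewrite fu fv !part_emb /= => ij; move: fu; rewrite ij -fv => /f_inj[uv_eq].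
by move: uv; rewrite uv_eq adj_irr.
Qed.
End Packing.

(** * Lower bound *)

Section LowerBound.
Variable R : realType.

(** The indicator of [U] is an eigenvector with eigenvalue [d]. *)
Lemma spec_radius_ge_degree (n r d : nat) (E : {set {set 'I_n}}) (U : {set 'I_n}) :
  (1 < r)%N -> uniform r E -> linear_hg E -> U != set0 ->
  (forall i, i \in U -> #|[set e in E | i \in e]| = d) ->
  (forall e, e \in E -> e \subset U) ->
  d%:R <= spec_radius R r E.
Proof.
move=> r1 E_unif E_lin /set0Pn[i0 i0U] U_deg U_cover.
have eig : tensor_eigenvalue r E (d%:R : R[i]).
  exists (fun i => (i \in U)%:R); split; first by exists i0; rewrite i0U oner_eq0.
  move=> i.
  rewrite (adj_tensor_sum (fun i => (i \in U)%:R) i (ltnW r1) E_unif).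
  transitivity (\sum_(e in E | i \in e) (1 : R[i])).
    apply: eq_bigr => e /andP[eE _]; rewrite big1 // => j; rewrite inE => /andP[_ je].
    by rewrite (subsetP (U_cover e eE)).
  rewrite sumr_const; have [iU|iU] := boolP (i \in U).
    rewrite expr1n mulr1 -(U_deg i iU); congr (_%:R).
    by apply: eq_card => e; rewrite inE.
  (* Outside [U] there are no edges, and the right-hand side vanishes because [r - 1 > 0]. *)
  rewrite expr0n; case: r r1 {E_unif} => [|[|r]] // _; rewrite mulr0 eq_card0 // => e.
  rewrite unfold_in; apply/andP => -[eE ie]; case/negP: iU.
  exact: (subsetP (U_cover e eE)).
rewrite -(cmod_nat R d); apply: ub_le_sup; last by exists d%:R.
by exists n%:R => _ [l l_eig <-]; exact: eigenvalue_le_order l_eig.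
Qed.

Lemma spex_lin_ge (n r : nat) (V : finType) (adj : rel V) (E : {set {set 'I_n}}) :
  (1 < r)%N -> uniform r E -> linear_hg E -> ~ contains_copy (expansion adj r) E ->
  spec_radius R r E <= spex_lin R r adj n.
Proof.
move=> r1 E_unif E_lin E_free; apply: ub_le_sup; last by exists E.
by exists n%:R => _ [E' [E'_unif [E'_lin _]] <-]; exact: spec_radius_le_order.
Qed.

Lemma spex_lin_ge_packing (K r n : nat) (G : finZmodType) (Z : finType)
  (pos : {set 'I_K} -> 'I_K -> Z -> G) (V : finType) (adj : rel V) :
  (0 < K)%N -> (1 < r)%N ->
  (forall (S S' : {set 'I_K}) (i j : 'I_K) z z', (i < j)%N ->
    #|S| = r -> #|S'| = r -> i \in S -> j \in S -> i \in S' -> j \in S' ->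
    pos S j z - pos S i z = pos S' j z' - pos S' i z' -> S = S' /\ z = z') ->
  irreflexive adj -> ~ colorable adj K -> (K * #|G| <= n)%N ->
  ('C(K.-1, r.-1) * #|Z|)%:R <= spex_lin R r adj n.
Proof.
move=> K0 r1 pos_inj adj_irr not_col n_large.
have card_n : (#|{: 'I_K * G}| <= n)%N by rewrite card_prod card_ord.
pose emb (u : 'I_K * G) : 'I_n := widen_ord card_n (enum_rank u).
have emb_inj : injective emb by move=> u v /(congr1 val) /= /val_inj/enum_rank_inj.
pose E := packing r pos emb.
have E_unif : uniform r E := packing_uniform emb_inj.
have E_lin : linear_hg E := packing_linear pos_inj emb_inj.
apply: le_trans (spex_lin_ge r1 E_unif E_lin (packing_free emb_inj K0 adj_irr not_col)).
apply: (@spec_radius_ge_degree _ _ _ _ (emb @: [set: 'I_K * G])) => //.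
- by apply/set0Pn; exists (emb (Ordinal K0, 0)); rewrite imset_f.
- by move=> _ /imsetP[u _ ->]; exact: packing_degree.
move=> _ /packing_edgeP[q _ ->]; apply/subsetP => _ /imsetP[i _ ->].
by rewrite imset_f.
Qed.

Lemma Zp_mulrn_inj Q d : coprime d Q.+1 -> injective (fun y : 'I_Q.+1 => y *+ d).
Proof.
move=> d_co y y' /= yd; apply/eqP; rewrite -subr_eq0; set v := y - y'.
have : v *+ d = 0 by rewrite mulrnBl yd subrr.
rewrite Zp_mulrn => /(congr1 val) /= /eqP; rewrite -/(dvdn Q.+1 _) => v_dvd.
have : (Q.+1 %| v)%N by rewrite -(@Gauss_dvdl _ _ d) // coprime_sym.
case: (posnP v) => [v0 _|v_gt0 /(dvdn_leq v_gt0)]; last by rewrite leqNgt ltn_ord.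
exact/eqP/val_inj.
Qed.

Lemma natr_Fp_inj p : prime p -> {in gtn p &, injective (fun m => m%:R : 'F_p)}.
Proof.
move=> p_prime a b; rewrite !unfold_in => a_p b_p /(congr1 val) /=.
by rewrite !val_Fp_nat // !modn_small.
Qed.

(** As [K!] divides [Q], every positive [d < K] is coprime to [Q + 1], so multiplication by [d] is
    injective on the cyclic component. *)
Lemma spex_lin_ge_prime (K r n p Q : nat) (V : finType) (adj : rel V) :
  (1 < r <= K)%N -> prime p -> (K < p)%N -> (K`! %| Q)%N ->
  irreflexive adj -> ~ colorable adj K ->
  (K * (p * p ^ #|gadget_index K| * Q.+1) <= n)%N ->
  ('C(K.-1, r.-1) * (p %/ 'C(K - 2, r - 2) * p ^ #|gadget_index K| * Q.+1))%:R
    <= spex_lin R r adj n.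
Proof.
case/andP=> r1 rK p_prime K_p Q_dvd adj_irr not_col n_large.
have K0 : (0 < K)%N by exact: leq_trans (ltnW r1) rK.
have Q_coprime d : (0 < d < K)%N -> coprime d Q.+1.
  case/andP=> d0 dK; apply: coprime_dvdl (coprimenS Q).
  by apply: dvdn_trans Q_dvd; rewrite dvdn_fact // d0 ltnW.
have card_blocks (i j : 'I_K) : (i < j)%N ->
    (#|blocks_through r i j| <= 'C(K - 2, r - 2))%N.
  move=> ij; have card2 : #|[set i; j]| = 2 by rewrite cards2 -val_eqE ltn_eqF.
  have <- : #|[set S : {set 'I_K} | (#|S| == r) && ([set i; j] \subset S)]| = 'C(K - 2, r - 2).
    by rewrite card_supersets card2 // card_ord.
  apply/subset_leq_card/subsetP => S; rewrite !inE => /and3P[-> iS jS].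
  by rewrite subUset !sub1set iS jS.
have pos_inj (S S' : {set 'I_K}) (i j : 'I_K) z z' : (i < j)%N ->
    #|S| = r -> #|S'| = r -> i \in S -> j \in S -> i \in S' -> j \in S' ->
    @block_pos 'F_p 'I_Q.+1 p K r 'C(K - 2, r - 2) S j z - block_pos r S i z =
    block_pos r S' j z' - block_pos r S' i z' -> S = S' /\ z = z'.
  move=> ij S_r S'_r iS jS iS' jS'.
  apply: (block_pos_diff_inj (natr_Fp_inj p_prime) K_p) => //.
  - by move=> d /Q_coprime/Zp_mulrn_inj.
  - by rewrite inE S_r eqxx iS.
  - by rewrite inE S'_r eqxx iS'.
have card_F : #|{ffun gadget_index K -> 'F_p}| = (p ^ #|gadget_index K|)%N.
  by rewrite card_ffun card_Fp.
have card_G : #|block_group 'F_p 'I_Q.+1 K| = (p * p ^ #|gadget_index K| * Q.+1)%N.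
  rewrite -card_F -[X in (X * _ * _)%N](card_Fp p_prime).
  by rewrite -[X in (_ * X)%N](card_ord Q.+1) -!card_prod.
have card_Z : #|block_param 'F_p 'I_Q.+1 p K 'C(K - 2, r - 2)| =
    (p %/ 'C(K - 2, r - 2) * p ^ #|gadget_index K| * Q.+1)%N.
  by rewrite -card_F -[X in (X * _ * _)%N]card_ord -[X in (_ * X)%N](card_ord Q.+1) -!card_prod.
rewrite -card_Z; apply: spex_lin_ge_packing K0 r1 pos_inj adj_irr not_col _.
by rewrite card_G.
Qed.

(** The prime [p] is fixed first, depending only on [r], [K] and [eps]; then [Q] grows with [n] so
    that the parts fill all but a bounded number of vertices. *)
Lemma spex_lin_lower (r K : nat) (V : finType) (adj : rel V) (eps : R) :
  (1 < r <= K)%N -> 0 < eps -> irreflexive adj -> ~ colorable adj K ->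
  exists n0 : nat, forall n, (n0 <= n)%N ->
    (1 - K%:R^-1 - eps) * n%:R <= (r.-1)%:R * spex_lin R r adj n.
Proof.
move=> rK eps0 adj_irr not_col; have /andP[r1 r_K] := rK.
set N := 'C(K - 2, r - 2).
have N0 : (0 < N)%N by rewrite bin_gt0 leq_sub2r.
(* Makes [N / p] at most [eps / 2], which controls the rounding in [p %/ N]. *)
have [p p_large p_prime] := prime_above (K + N + Num.bound (2 * N%:R / eps : R)).
have K_p : (K < p)%N by lia.
have N_p : (N < p)%N by lia.
have K0 : (0 < K)%N by lia.
have p0 : 0 < p%:R :> R by rewrite ltr0n prime_gt0.
set m := #|gadget_index K|; pose T := K`!; pose W := (K * (p * p ^ m))%N.
have Np_eps : N%:R / p%:R <= eps / 2.
  have /archi_boundP Np : (0 : R) <= 2 * N%:R / eps.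
    by rewrite divr_ge0 ?mulr_ge0 ?ler0n // ltW.
  have {Np} : 2 * N%:R / eps <= p%:R by apply: le_trans (ltW Np) _; rewrite ler_nat; lia.
  rewrite !ler_pdivrMr // => Np; lra.
exists (W + Num.bound (2 * (W * T)%:R / eps : R))%N => n n_large.
have WT_eps : (W * T)%:R <= eps / 2 * n%:R.
  have /archi_boundP Wn : (0 : R) <= 2 * (W * T)%:R / eps.
    by rewrite divr_ge0 ?mulr_ge0 ?ler0n // ltW.
  have {Wn} : 2 * (W * T)%:R / eps <= n%:R.
    by apply: le_trans (ltW Wn) _; rewrite ler_nat (leq_trans _ n_large) ?leq_addl.
  rewrite ler_pdivrMr // => Wn; lra.
(* The largest [h] for which [Q = h * T] fits, as [W * (h * T + 1) <= n]; fewer than [W * T]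
   vertices are left over. *)
pose h := ((n - W) %/ (W * T))%N.
have W0 : (0 < W)%N by rewrite !muln_gt0 K0 prime_gt0 // expn_gt0 prime_gt0.
have T0 : (0 < T)%N by exact: fact_gt0.
have Q_le : (W * (h * T).+1 <= n)%N.
  rewrite mulnS mulnCA -leq_subRL; last by lia.
  exact: leq_trunc_div.
have Q_ge : (n <= W * (h * T).+1 + W * T)%N.
  have : (n - W < h.+1 * (W * T))%N by rewrite ltn_ceil // muln_gt0 W0.
  rewrite mulnS mulSn mulnCA; lia.
have := @spex_lin_ge_prime K r n p (h * T) V adj rK p_prime K_p (dvdn_mull _ (dvdnn _))
  adj_irr not_col.
rewrite -/N -/m mulnA => /(_ Q_le).
set s := (p %/ N)%N; set q := (h * T).+1 in Q_ge *; set C1 := 'C(_, _).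
set S := spex_lin _ _ _ _ => S_ge.
have s_ge : (p <= s * N + N)%N.
  by have := ltn_ceil p N0; rewrite mulSn addnC => /ltnW.
(* This identity cancels the factor [1 / N] lost in the number of parameters, leaving [K - 1] times
   nearly the order of the group. *)
have C1_eq : (r.-1 * C1 = K.-1 * N)%N.
  rewrite /C1 /N (_ : r - 2 = r.-1.-1)%N; last by lia.
  rewrite (_ : K - 2 = K.-1.-1)%N; last by lia.
  by rewrite mul_bin_diag prednK // -ltnS prednK // ltnW.
have main : (K.-1 * (p - N) * p ^ m * q)%:R <= (r.-1)%:R * S.
  apply: le_trans (ler_wpM2l (ler0n _ _) S_ge); rewrite -natrM ler_nat.
  rewrite mulnA C1_eq.
  have -> : (K.-1 * N * (s * p ^ m * q) = K.-1 * (s * N) * p ^ m * q)%N by ring.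
  by rewrite !leq_mul // leq_subLR addnC.
apply: le_trans main.
have K0R : 0 < K%:R :> R by rewrite ltr0n.
pose x : R := (W * q)%:R.
have -> : (K.-1 * (p - N) * p ^ m * q)%:R = (1 - K%:R^-1) * ((1 - N%:R / p%:R) * x) :> R.
  rewrite /x /W !natrM natrB ?(ltnW N_p) // -subn1 natrB //.
  by field; rewrite !gt_eqF.
have x_le : x <= n%:R by rewrite ler_nat.
have x_ge : n%:R - (W * T)%:R <= x by rewrite lerBlDr -natrD ler_nat.
have bx : N%:R / p%:R * x <= eps / 2 * n%:R.
  by apply: ler_pM => //; rewrite ?divr_ge0 ?ler0n.
have K1 : 0 <= 1 - K%:R^-1 :> R by rewrite subr_ge0 invf_le1 ?ler1n.
(* Half of [eps] pays for the rounding of [p / N], the other half for the uncovered vertices. *)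
apply: le_trans (_ : (1 - K%:R^-1) * ((1 - eps) * n%:R) <= _).
  rewrite mulrA ler_wpM2r ?ler0n //.
  have : 0 <= K%:R^-1 * eps by rewrite mulr_ge0 ?invr_ge0 ?ltW.
  lra.
by apply: ler_wpM2l => //; lra.
Qed.
End LowerBound.

(** * The limit, from the two bounds *)

Local Open Scope classical_set_scope.

Theorem theorem1p6 (R : realType) (r k : nat) (V : finType) (adj : rel V) :
  (3 <= r.+1 <= k)%N ->
  simple_graph adj ->
  chromatic_number_is adj k ->
  (fun n : nat => spex_lin R r adj n / n%:R) @ \oo -->
    ((r%:R - 1)^-1 * (1 - (k%:R - 1)^-1) : R).
Proof.
move=> /andP[r_gt r_k] adj_simple [adj_col k_min].
case: k => [|K] in r_k adj_col k_min *; first by move: r_k; rewrite leqn0.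
have r1 : (1 < r)%N by rewrite -ltnS.
have rK : (1 < r <= K)%N by rewrite r1.
have K0 : (0 < K)%N by apply: leq_trans (ltnW r1) _.
have not_col : ~ colorable adj K by move=> /k_min; rewrite ltnn.
have -> : r%:R - 1 = (r.-1)%:R :> R by rewrite -subn1 natrB // ltnW.
have -> : K.+1%:R - 1 = K%:R :> R by rewrite -natr1 addrK.
have m1 : 1 <= (r.-1)%:R :> R by rewrite ler1n; case: (r) r1 => [|[]].
have m0 : 0 < (r.-1)%:R :> R by exact: lt_le_trans m1.
apply/cvgrPdist_le => eps eps0.
have [n1 upper] := spex_lin_upper r1 K0 eps0 adj_simple adj_col.
have [n2 lower] := spex_lin_lower rK eps0 adj_simple.2 not_col.
near=> n.
have n0 : 0 < n%:R :> R by rewrite ltr0n; near: n; exists 1.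
have {upper} up : (r.-1)%:R * spex_lin R r adj n <= (1 - K%:R^-1 + eps) * n%:R.
  by apply: upper; near: n; exists n1.
have {lower} low : (1 - K%:R^-1 - eps) * n%:R <= (r.-1)%:R * spex_lin R r adj n.
  by apply: lower; near: n; exists n2.
rewrite -(ler_pM2l m0) -[X in X * `|_|](gtr0_norm m0) -normrM mulrBr mulVKf ?gt_eqF //.
(* Both bounds are multiplied by [r - 1], and an error [eps] after this multiplication is enough
   because [r - 1 >= 1]. *)
apply: (@le_trans _ _ eps); last by rewrite ler_peMl ?(ltW eps0).
rewrite mulrA ler_distlC; apply/andP; split.
  by rewrite ler_pdivlMr.
by rewrite ler_pdivrMr.
Unshelve. all: by end_near. Qed.
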